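(* Let $n\in \mathbb{Z}_{\ge 1}$. Let $H$ be a compact metrizable space and let $v_1,\dots,v_{n+1}$ be $n+1$ pairwise distinct points of $H$. Let $\mathscr{S}$ be any one of $\mathscr{C}$, $\mathscr{P}$, $\mathscr{G}$, $\mathscr{Z}$. Let $(X_1,d_1),\dots,(X_{n+1},d_{n+1})$ be elements of $\mathscr{S}$ such that $d_{GH}((X_i,d_i),(X_j,d_j))>0$ for all distinct $i,j$. Then there exists a topological embedding $\Phi: H\to \mathscr{S}$ (with $\mathscr{S}$ carrying the topology of the Gromov--Hausdorff distance) such that $\Phi(v_i)=(X_i,d_i)$ for all $i\in\{1,\dots,n+1\}$.
   Context: For metric spaces $(X,d),(Y,e)$, the Gromov--Hausdorff distance $d_{GH}((X,d),(Y,e))$ is the infimum of the Hausdorff distances $d_H(i(X),j(Y))$ over all metric spaces $(Z,h)$ and isometric embeddings $i:X\to Z$, $j:Y\to Z$. $\mathscr{M}$ denotes the set of isometry classes of non-empty compact metric spaces, equipped with the metric $d_{GH}$ (the Gromov--Hausdorff space). A geodesic from $x$ to $y$ in $(X,d)$ is a map $\gamma:[0,1]\to X$ with $\gamma(0)=x$, $\gamma(1)=y$ and $d(\gamma(s),\gamma(t))=|s-t|\,d(x,y)$ for all $s,t$; a geodesic space is one in which any two points are joined by a geodesic. A CAT(0) space is a geodesic space in which, for every geodesic triangle $\triangle$ and all $x,y\in\triangle$, $d(x,y)\le |\bar x-\bar y|$ where $\bar x,\bar y$ are the comparison points in a Euclidean comparison triangle in $\mathbb{R}^2$. $\mathscr{C}$,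 $\mathscr{P}$, $\mathscr{G}$, $\mathscr{Z}$ denote the subsets of $\mathscr{M}$ consisting of all compact metric spaces that are, respectively, connected, path-connected, geodesic, and CAT(0). *)

(* Defs.v *)
From HB Require Import structures.
From mathcomp Require Import all_boot all_order all_algebra.
From mathcomp Require Import all_classical all_reals all_analysis.
From mathcomp Require Import Rstruct Rstruct_topology.
Set Implicit Arguments. Unset Strict Implicit. Unset Printing Implicit Defensive.
Import Order.TTheory GRing.Theory Num.Theory.
Local Open Scope classical_set_scope.
Local Open Scope ring_scope.

Notation R := Rdefinitions.R.

Definition is_metric (T : Type) (d : T -> T -> R) : Prop :=
  (forall x y, d x y = 0 <-> x = y) /\
  (forall x y, d x y = d y x) /\
  (forall x y z, d x z <= d x y + d y z).

Definition metric_open (T : Type) (d : T -> T -> R) (U : set T) : Prop :=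
  forall x, U x -> exists e : R, 0 < e /\ forall y, d x y < e -> U y.

Definition metric_compact (T : Type) (d : T -> T -> R) : Prop :=
  forall (I : Type) (U : I -> set T),
    (forall i, metric_open d (U i)) -> (forall x, exists i, U i x) ->
    exists l : list I, forall x, exists i, List.In i l /\ U i x.

(** a (representative of a point of the Gromov--Hausdorff space):
    non-empty compact metric space *)
Record CMS := {
  car :> Type;
  dist : car -> car -> R;
  dist_metric : is_metric dist;
  car_nonempty : inhabited car;
  car_compact : metric_compact dist }.

Definition isometric_emb (X Z : Type) (dX : X -> X -> R) (dZ : Z -> Z -> R)
  (i : X -> Z) : Prop := forall x y, dZ (i x) (i y) = dX x y.

Definition hausdorff_dist (Z : Type) (h : Z -> Z -> R) (A B : set Z) : R :=
  inf [set r : R | 0 <= r /\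
        (forall a, A a -> exists2 b, B b & h a b <= r) /\
        (forall b, B b -> exists2 a, A a & h a b <= r)].

Definition dGH (X Y : CMS) : R :=
  inf [set r : R | exists (Z : Type) (h : Z -> Z -> R) (i : X -> Z) (j : Y -> Z),
        [/\ is_metric h, isometric_emb (@dist X) h i, isometric_emb (@dist Y) h j &
            r = hausdorff_dist h (range i) (range j)]].

Definition in01 (s : R) : Prop := 0 <= s /\ s <= 1.

Definition is_path (T : Type) (d : T -> T -> R) (g : R -> T) : Prop :=
  forall s, in01 s -> forall e : R, 0 < e -> exists2 del : R, 0 < del &
    forall t, in01 t -> `|s - t| < del -> d (g s) (g t) < e.

Definition geodesic (T : Type) (d : T -> T -> R) (x y : T) (g : R -> T) : Prop :=
  g 0 = x /\ g 1 = y /\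
  forall s t, in01 s -> in01 t -> d (g s) (g t) = `|s - t| * d x y.

Definition is_connected_ms (X : CMS) : Prop :=
  forall U V : set X, metric_open (@dist X) U -> metric_open (@dist X) V ->
    (forall x, U x \/ V x) -> (exists x, U x) -> (exists x, V x) ->
    exists x, U x /\ V x.

Definition is_path_connected_ms (X : CMS) : Prop :=
  forall x y : X, exists g : R -> X, [/\ is_path (@dist X) g, g 0 = x & g 1 = y].

Definition is_geodesic_ms (X : CMS) : Prop :=
  forall x y : X, exists g : R -> X, geodesic (@dist X) x y g.

Definition eucl (a b : R * R) : R :=
  Num.sqrt ((a.1 - b.1) ^+ 2 + (a.2 - b.2) ^+ 2).
Definition lerp (a b : R * R) (s : R) : R * R :=
  ((1 - s) * a.1 + s * b.1, (1 - s) * a.2 + s * b.2).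

Definition is_CAT0_ms (X : CMS) : Prop :=
  is_geodesic_ms X /\
  forall (p q r : X) (g1 g2 g3 : R -> X),
    geodesic (@dist X) p q g1 -> geodesic (@dist X) q r g2 -> geodesic (@dist X) r p g3 ->
    forall P Q S : R * R,
      eucl P Q = dist p q -> eucl Q S = dist q r -> eucl S P = dist r p ->
      let side (k : nat) : R -> X :=
        match k with 0%N => g1 | 1%N => g2 | _ => g3 end in
      let cside (k : nat) : R -> R * R :=
        match k with 0%N => lerp P Q | 1%N => lerp Q S | _ => lerp S P end in
      forall (k l : nat) (s t : R), (k < 3)%N -> (l < 3)%N -> in01 s -> in01 t ->
        dist (side k s) (side l t) <= eucl (cside k s) (cside l t).

Inductive GHclass := ClassC | ClassP | ClassG | ClassZ.

Definition in_class (S : GHclass) (X : CMS) : Prop :=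
  match S with
  | ClassC => is_connected_ms X
  | ClassP => is_path_connected_ms X
  | ClassG => is_geodesic_ms X
  | ClassZ => is_CAT0_ms X
  end.

Definition metrizable (H : topologicalType) : Prop :=
  exists d : H -> H -> R, is_metric d /\
    forall (x : H) (U : set H),
      nbhs x U <-> exists e : R, 0 < e /\ forall y, d x y < e -> U y.

(** topological embedding of H into (S, d_GH) modulo isometry:
    values in S, continuous, injective on isometry classes (d_GH > 0),
    and a homeomorphism onto its image *)
Definition GH_embedding (H : topologicalType) (S : GHclass) (Phi : H -> CMS) : Prop :=
  [/\ forall x, in_class S (Phi x),
      forall x (e : R), 0 < e -> \forall y \near x, dGH (Phi x) (Phi y) < e,
      forall x y, x <> y -> 0 < dGH (Phi x) (Phi y) &
      forall x (U : set H), nbhs x U ->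
        exists2 e : R, 0 < e & forall y, dGH (Phi x) (Phi y) < e -> U y].

(* Main.v *)
Require Import Defs.
From HB Require Import structures.
From mathcomp Require Import all_boot all_order all_algebra.
From mathcomp Require Import all_classical all_reals all_analysis.
From mathcomp Require Import Rstruct Rstruct_topology.
From mathcomp Require Import ring lra.
Set Implicit Arguments. Unset Strict Implicit. Unset Printing Implicit Defensive.

Import Order.TTheory GRing.Theory Num.Theory.
Local Open Scope classical_set_scope.
Local Open Scope ring_scope.

(* Every [X i] is shrunk by a weight [zeta_i(x)] with [zeta_i(v_j) = delta_ij],
   and [Phi(x)] is the l2-product of the shrunk spaces with a star (infinitely
   many segments glued at one endpoint) whose leg lengths carry the information
   about [x] and vanish exactly when [x] is one of the [v_i].  All [Phi(x)] are
   metric quotients of pseudometrics on one fixed set, and these pseudometrics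
   depend on [x] in a Lipschitz way, so [Phi] is continuous.  Each of the four
   classes is stable under scaling and l2-products; for CAT(0) this is clear from
   the inequality of Bruhat and Tits.

   Level [k] of the star consists of legs of length
   [2^-k rho(x) (1 + min(1, d(x, z_k)))], where [rho] is the distance to the
   [v_i] and [z] is a dense sequence of [H] visiting every ball infinitely often.
   The number of legs of level [k] is chosen so large, compared with the covering
   numbers of the [X i] and of the earlier levels at a scale much smaller than
   [2^-k], that the packing number of [Phi(x)] determines the length of these
   legs up to [o(2^-k)].  So spaces at distance [0] have the same
   [rho(x) (1 + min(1, d(x, w)))] for all [w], which forces [x = y] or
   [rho(x) = rho(y) = 0]. *)

(** * Compactness and correspondences *)

Definition pseudometric (T : Type) (d : T -> T -> R) : Prop :=
  [/\ forall x, d x x = 0, forall x y, d x y = d y x &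
      forall x y z, d x z <= d x y + d y z].

Lemma is_metric_pseudometric (T : Type) (d : T -> T -> R) :
  is_metric d -> pseudometric d.
Proof. by case=> d0 [dC dD]; split=> // x; apply/d0. Qed.

Lemma pseudometric_ge0 (T : Type) (d : T -> T -> R) (dP : pseudometric d) x y :
  0 <= d x y.
Proof. by case: dP => d0 dC dD; have := dD x y x; rewrite d0 (dC y x); lra. Qed.

Lemma pseudometric_distl (T : Type) (d : T -> T -> R) (dP : pseudometric d) x y z :
  `|d x z - d y z| <= d x y.
Proof.
case: dP => d0 dC dD; rewrite ler_norml.
have := dD x y z; have := dD y x z; rewrite (dC y x); lra.
Qed.

Lemma pseudometric_dist2 (T : Type) (d : T -> T -> R) (dP : pseudometric d)
  x y x' y' : `|d x y - d x' y'| <= d x x' + d y y'.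
Proof.
case: dP => d0 dC dD; rewrite ler_norml.
have := dD x x' y; have := dD x' y' y; have := dD x' x y'; have := dD x y y'.
by rewrite (dC x' x) (dC y' y); lra.
Qed.

Lemma pseudometric_ball_open (T : Type) (d : T -> T -> R) (dP : pseudometric d) x e :
  metric_open d [set y | d x y < e].
Proof.
move=> y /= xy; exists (e - d x y); split; first lra.
by move=> z yz; case: dP => _ _ /(_ x y z); lra.
Qed.

Lemma dist_pseudometric (X : CMS) : pseudometric (@dist X).
Proof. exact/is_metric_pseudometric/dist_metric. Qed.

(** Compactness as convergence of ultrafilters: products, scalings and stars are then handled by
    finding limits, without covers. *)
Definition ultra_compact (T : Type) (d : T -> T -> R) : Prop :=
  forall F : set_system T, UltraFilter F ->
    exists x, forall e, 0 < e -> F [set y | d x y < e].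

Lemma list_In_union_ultra (T I : Type) (F : set_system T) (U : I -> set T)
  (l : list I) : UltraFilter F -> F [set x | exists i, List.In i l /\ U i x] ->
  exists i, List.In i l /\ F (U i).
Proof.
move=> FU; have FP := @ultra_proper _ _ FU.
elim: l => [|i l IHl] Fl.
  by exfalso; apply: (@filter_not_empty _ F); apply: filterS Fl => x [i []].
have [Ui|nUi] := in_ultra_setVsetC (U i) FU.
  by exists i; split=> //; left.
have [|j [jl Uj]] := IHl.
  apply: filterS2 nUi Fl => x /= nUx [j [[<-//|jl] Ux]]; by exists j.
by exists j; split=> //; right.
Qed.

(** If an ultrafilter converges nowhere, every point has a ball outside it, and finitely many such
    balls cover the space. Conversely, if no finite subfamily covers, the complements of finite
    unions generate a proper filter, and the limit of an ultrafilter above it would lie in no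
    [U i]. *)
Lemma metric_compact_ultraP (T : Type) (d : T -> T -> R) (dP : pseudometric d) :
  metric_compact d <-> ultra_compact d.
Proof.
split=> [cT F FU|cT I U Uo Ucov].
  apply: contrapT => /forallNP ncv.
  have {}ncv x : exists e, 0 < e /\ ~ F [set y | d x y < e].
    have /existsNP[e /not_implyP[e0 nF]] := ncv x; by exists e.
  pose r x := sval (cid (ncv x)).
  have rP x : 0 < r x /\ ~ F [set y | d x y < r x] by exact: (svalP (cid (ncv x))).
  have [||l lP] := cT T (fun x => [set y | d x y < r x]).
  - by move=> x; exact: pseudometric_ball_open.
  - by move=> x; exists x; case: dP => /= -> _ _; case: (rP x).
  have FP := @ultra_proper _ _ FU.
  have [|x [_ Fx]] :=
      list_In_union_ultra (U := fun x => [set y | d x y < r x]) (l := l) FU.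
    by apply: filterS filterT => x _; exact: lP.
  by case: (rP x).
apply: contrapT => /forallNP nfin.
pose B (l : list I) := [set x | forall i, List.In i l -> ~ U i x].
have FF : ProperFilter (filter_from [set: list I] B).
  apply: filter_from_proper.
    apply: filter_from_filter; first by exists nil.
    move=> l l' _ _; exists (l ++ l')%list => // x xB; split=> i il; apply: xB;
      apply/List.in_or_app; by [left|right].
  move=> l _; have /existsNP[x /forallNP xl] := nfin l.
  by exists x => i il Ux; apply: (xl i).
have [G [GU FG]] := ultraFilterLemma FF.
have GP := @ultra_proper _ _ GU.
have [x Gx] := cT G GU.
have [i Ux] := Ucov x.
have [e [e0 eU]] := Uo i x Ux.
have Gi : G (B (i :: nil)%list) by apply: FG; exists (i :: nil)%list.
have [y []] := filter_ex (filterI (Gx e e0) Gi).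
by move=> /eU Uy /(_ i); apply => //; left.
Qed.

Lemma metric_compact_bounded (T : Type) (d : T -> T -> R) (dP : pseudometric d) :
  metric_compact d -> exists B : R, forall x y, d x y <= B.
Proof.
move=> cT; have [[x0]|nT] := pselect (inhabited T); last first.
  by exists 0 => x; case: nT; constructor.
have [||l lP] := cT nat (fun n => [set y | d x0 y < n%:R]).
- by move=> n; exact: pseudometric_ball_open.
- move=> x; exists (Num.truncn (d x0 x)).+1 => /=.
  by rewrite truncnS_gt.
have [N NP] : exists N, forall n, List.In n l -> (n <= N)%N.
  elim: l {lP} => [|m l [N NP]]; first by exists 0%N.
  exists (maxn m N) => n [<-|/NP nN]; first exact: leq_maxl.
  by rewrite leq_max nN orbT.
have xN x : d x0 x <= N%:R.
  have [n [/NP nN /= /ltW xn]] := lP x; apply: le_trans xn _.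
  by rewrite ler_nat.
exists (N%:R + N%:R) => x y.
case: dP => _ dC /(_ x x0 y) /le_trans; apply.
by rewrite (dC x x0) lerD.
Qed.

(** A finite colouring stands in for a covering number: among more than [P] points, two have the
    same colour and hence distance at most [e]. *)
Lemma metric_compact_classes (T : Type) (d : T -> T -> R) (dP : pseudometric d) e :
  metric_compact d -> 0 < e ->
  exists P : nat, exists cl : T -> 'I_P, forall x y, cl x = cl y -> d x y <= e.
Proof.
move=> cT e0.
have [||l lP] := cT T (fun x => [set y | d x y < e / 2]).
- by move=> n; exact: pseudometric_ball_open.
- by move=> x; exists x => /=; case: dP => -> _ _; rewrite divr_gt0.
have clP x : exists k : 'I_(length l), d (List.nth k l x) x < e / 2.
  have [y [yl yx]] := lP x.
  have [k [/ssrnat.ltP kl ky]] := List.In_nth l y x yl.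
  by exists (Ordinal kl); rewrite /= ky.
exists (length l), (fun x => sval (cid (clP x))) => x y xy.
have := svalP (cid (clP x)); have := svalP (cid (clP y)); rewrite -xy.
set k := sval _.
(* The default of [List.nth] was the coloured point itself, so it differs for [x] and [y]; the index
   is in range, so it can be exchanged. *)
rewrite (@List.nth_indep _ l k y x); last exact/ssrnat.ltP.
by case: dP => _ dC /(_ x (List.nth k l x) y); rewrite (dC x (List.nth k l x)); lra.
Qed.

(** * The sup metric on bounded functions *)

Section sup_metric.
Variable W : Type.
Hypothesis W0 : inhabited W.

Definition bounded_function : Type := {f : W -> R | exists B, forall w, `|f w| <= B}.

Definition sup_dist (f g : bounded_function) : R :=
  sup (range (fun w => `|sval f w - sval g w|)).

Lemma sup_dist_le (f g : bounded_function) e :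
  (forall w, `|sval f w - sval g w| <= e) -> sup_dist f g <= e.
Proof.
move=> fe; apply: ge_sup; last by move=> _ [w _ <-].
by case: W0 => w; exists (`|sval f w - sval g w|), w.
Qed.

Lemma sup_dist_ge (f g : bounded_function) w :
  `|sval f w - sval g w| <= sup_dist f g.
Proof.
apply: ub_le_sup; last by exists w.
case: f g => f [B fB] [g [C gC]]; exists (B + C) => _ [z _ <-] /=.
by rewrite (le_trans (ler_normB _ _))// lerD.
Qed.

Lemma sup_dist_metric : is_metric sup_dist.
Proof.
split=> [f g|]; [split=> [fg|->]|split=> [f g|f g h]].
- case: f g fg => f fB [g gB] fg; apply: eq_exist; apply: funext => w.
  have := sup_dist_ge (exist _ f fB) (exist _ g gB) w.
  by rewrite fg normr_le0 subr_eq0 => /eqP.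
- case: (W0) => w; apply/eqP; rewrite eq_le; apply/andP; split.
    by apply: sup_dist_le => z; rewrite subrr normr0.
  by have := sup_dist_ge g g w; rewrite subrr normr0.
- by rewrite /sup_dist; congr sup; apply: eq_imagel => w _; rewrite distrC.
- apply: sup_dist_le => w.
  by rewrite (le_trans (ler_distD (sval g w) _ _))// lerD// sup_dist_ge.
Qed.

End sup_metric.

(** * Gromov-Hausdorff distance through correspondences *)

Lemma hausdorff_dist_ge0 (Z : Type) (h : Z -> Z -> R) (A B : set Z) :
  0 <= hausdorff_dist h A B.
Proof.
rewrite /hausdorff_dist; set E := [set _ | _].
(* By convention [inf] of the empty set is [0]. *)
have [->|/set0P E0] := eqVneq E set0; first by rewrite inf0.
by apply: lb_le_inf => // r [].
Qed.

Lemma dGH_ge0 (X Y : CMS) : 0 <= dGH X Y.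
Proof.
rewrite /dGH; set E := [set _ | _].
have [->|/set0P E0] := eqVneq E set0; first by rewrite inf0.
by apply: lb_le_inf => // _ [Z [h [i [j [_ _ _ ->]]]]]; exact: hausdorff_dist_ge0.
Qed.

(** The number [e] bounds the distortion of [C]. Correspondences turn estimates of [dGH] into
    comparisons of two metrics, without an ambient space. *)
Definition correspondence (X Y : CMS) (e : R) (C : X -> Y -> Prop) : Prop :=
  [/\ forall x, exists y, C x y, forall y, exists x, C x y &
      forall x x' y y', C x y -> C x' y' -> `|dist x x' - dist y y'| <= e].

(* The Kuratowski maps [x |-> d(x, .)] and [y |-> d(y, .)] into the bounded
   functions on the graph of [C]; the constant is twice the optimal one. *)
Lemma correspondence_embedding (X Y : CMS) (e : R) (C : X -> Y -> Prop) :
  0 <= e -> correspondence e C ->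
  exists (Z : Type) (h : Z -> Z -> R) (i : X -> Z) (j : Y -> Z),
    [/\ is_metric h, isometric_emb (@dist X) h i, isometric_emb (@dist Y) h j &
      hausdorff_dist h (range i) (range j) <= e].
Proof.
move=> e0 [CX CY CC].
pose W : Type := {w : X * Y | C w.1 w.2}.
have W0 : inhabited W.
  by case: (car_nonempty X) => x; case: (CX x) => y xy; constructor; exists (x, y).
have [BX BXP] := metric_compact_bounded (dist_pseudometric X) (@car_compact X).
have [BY BYP] := metric_compact_bounded (dist_pseudometric Y) (@car_compact Y).
have nX (x x' : X) : `|dist x x'| = dist x x' :> R.
  exact: ger0_norm (pseudometric_ge0 (dist_pseudometric X) _ _).
have nY (y y' : Y) : `|dist y y'| = dist y y' :> R.
  exact: ger0_norm (pseudometric_ge0 (dist_pseudometric Y) _ _).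
have iB (x : X) : exists B, forall w : W, `|dist x (sval w).1| <= B.
  by exists BX => w; rewrite nX.
have jB (y : Y) : exists B, forall w : W, `|dist y (sval w).2| <= B.
  by exists BY => w; rewrite nY.
pose i x : bounded_function W := exist _ _ (iB x).
pose j y : bounded_function W := exist _ _ (jB y).
have ij x y : C x y -> sup_dist (i x) (j y) <= e.
  by move=> xy; apply: (sup_dist_le W0) => // -[[x' y'] /= xy']; exact: CC.
exists (bounded_function W), (@sup_dist W), i, j; split.
- exact: sup_dist_metric.
- move=> x x'; apply/eqP; rewrite eq_le; apply/andP; split.
    by apply: (sup_dist_le W0) => // w; exact/pseudometric_distl/dist_pseudometric.
  have [y xy] := CX x'.
  have := sup_dist_ge (i x) (i x') (exist _ (x', y) xy).
  by case: (dist_pseudometric X) => /= -> _ _; rewrite subr0 nX.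
- move=> y y'; apply/eqP; rewrite eq_le; apply/andP; split.
    by apply: (sup_dist_le W0) => // w; exact/pseudometric_distl/dist_pseudometric.
  have [x xy] := CY y'.
  have := sup_dist_ge (j y) (j y') (exist _ (x, y') xy).
  by case: (dist_pseudometric Y) => /= -> _ _; rewrite subr0 nY.
- apply: ge_inf; first by exists 0 => r [].
  split=> //; split=> [_ [x _ <-]|_ [y _ <-]].
    by have [y xy] := CX x; exists (j y); [exists y|exact: ij].
  by have [x xy] := CY y; exists (i x); [exists x|exact: ij].
Qed.

Lemma dGH_le_distortion (X Y : CMS) (e : R) (C : X -> Y -> Prop) :
  0 <= e -> correspondence e C -> dGH X Y <= e.
Proof.
move=> e0 /(correspondence_embedding e0)[Z [h [i [j [hP iP jP ije]]]]].
apply: le_trans ije; apply: ge_inf; last by exists Z, h, i, j.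
by exists 0 => _ [? [? [? [? [_ _ _ ->]]]]]; exact: hausdorff_dist_ge0.
Qed.

(** Points whose images lie within [s < r] of each other are related; the triangle inequality gives
    distortion at most [2 * s]. *)
Lemma dGH_lt_correspondence (X Y : CMS) (r : R) :
  dGH X Y < r -> exists C : X -> Y -> Prop, correspondence (2 * r) C.
Proof.
have [BX BXP] := metric_compact_bounded (dist_pseudometric X) (@car_compact X).
have [BY BYP] := metric_compact_bounded (dist_pseudometric Y) (@car_compact Y).
have [x0] := car_nonempty X; have [y0] := car_nonempty Y.
have BX0 : 0 <= BX.
  by rewrite (le_trans _ (BXP x0 x0)) ?(pseudometric_ge0 (dist_pseudometric X)).
have BY0 : 0 <= BY.
  by rewrite (le_trans _ (BYP y0 y0)) ?(pseudometric_ge0 (dist_pseudometric Y)).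
move=> /inf_lt[|_ [Z [h [i [j [hM iP jP ->]]]]]].
  (* The infimum is over a non-empty set: the full relation has distortion at most [BX + BY]. *)
  have := @correspondence_embedding X Y (BX + BY) (fun _ _ => True).
  case; first exact: addr_ge0.
    split=> [_|_|x x' y y' _ _]; [by exists y0|by exists x0|].
    rewrite (le_trans (ler_normB _ _))// lerD// ger0_norm//.
      exact: (pseudometric_ge0 (dist_pseudometric X)).
    exact: (pseudometric_ge0 (dist_pseudometric Y)).
  move=> Z [h [i [j [hP iP jP _]]]].
  by eexists; exists Z, h, i, j; split; last reflexivity.
have hP := is_metric_pseudometric hM.
move=> /inf_lt[|s [s0 [ijs jis]] sr].
  have hb (x : X) (y : Y) : h (i x) (j y) <= BX + h (i x0) (j y0) + BY.
    case: (hP) => _ hC hD; have := hD (i x) (i x0) (j y).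
    have := hD (i x0) (j y0) (j y); rewrite iP jP.
    by have := BXP x x0; have := BYP y0 y; lra.
  have hij := pseudometric_ge0 hP (i x0) (j y0).
  exists (BX + h (i x0) (j y0) + BY); split; first lra.
  split=> [_ [x _ <-]|_ [y _ <-]]; first by exists (j y0); [exists y0|].
  by exists (i x0); [exists x0|].
exists (fun x y => h (i x) (j y) <= s); split.
- by move=> x; have [|_ [y _ <-] xy] := ijs (i x); [exists x|exists y].
- by move=> y; have [|_ [x _ <-] xy] := jis (j y); [exists y|exists x].
- move=> x x' y y' xy xy'; rewrite -iP -jP.
  rewrite (le_trans (pseudometric_dist2 hP _ _ _ _))//; lra.
Qed.

(** Correspondences are composed. The factor [2] is harmless, since the bound is only applied with
    arbitrarily small [r] and [s]. *)
Lemma dGH_quasi_triangle (X Y Z : CMS) (r s : R) :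
  dGH X Y < r -> dGH Y Z < s -> dGH X Z <= 2 * (r + s).
Proof.
move=> XYr YZs.
have r0 := le_lt_trans (dGH_ge0 X Y) XYr.
have s0 := le_lt_trans (dGH_ge0 Y Z) YZs.
have [C [CX CY CC]] := dGH_lt_correspondence XYr.
have [D [DY DZ DD]] := dGH_lt_correspondence YZs.
apply: (@dGH_le_distortion _ _ _ (fun x z => exists2 y, C x y & D y z)); first lra.
split=> [x|z|x x' z z' [y xy yz] [y' xy' yz']].
- by have [y xy] := CX x; have [z yz] := DY y; exists z, y.
- by have [y yz] := DZ z; have [x xy] := CY y; exists x, y.
- apply: le_trans (ler_distD (dist y y') _ _) _.
  by have := CC _ _ _ _ xy xy'; have := DD _ _ _ _ yz yz'; lra.
Qed.

Lemma dGH_sym_le (X Y : CMS) (r : R) : dGH X Y < r -> dGH Y X <= 2 * r.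
Proof.
move=> XYr; have r0 := le_lt_trans (dGH_ge0 X Y) XYr.
have [C [CX CY CC]] := dGH_lt_correspondence XYr.
apply: (@dGH_le_distortion _ _ _ (fun y x => C x y)); first lra.
by split=> // y y' x x' xy xy'; rewrite distrC; exact: CC.
Qed.

(** * The inequality of Bruhat and Tits *)

(** Every parameter [t] is allowed, not only the midpoint, so that geodesics arise without a limit
    of repeated bisections. *)
Definition CN (T : Type) (d : T -> T -> R) : Prop :=
  forall x y t, in01 t -> exists m, forall p,
    d p m ^+ 2 <= (1 - t) * d p x ^+ 2 + t * d p y ^+ 2 - t * (1 - t) * d x y ^+ 2.

(* The four classes for pseudometrics, in the form that passes to products:
   connectedness through locally constant functions, and CAT(0) through the
   inequality of Bruhat and Tits. *)
Definition pseudo_class (S : GHclass) (T : Type) (d : T -> T -> R) : Prop :=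
  match S with
  | ClassC => forall f : T -> bool,
      (forall x, exists2 e, 0 < e & forall y, d x y < e -> f x = f y) ->
      forall x y, f x = f y
  | ClassP => forall x y, exists g : R -> T, [/\ is_path d g, g 0 = x & g 1 = y]
  | ClassG => forall x y, exists g : R -> T, geodesic d x y g
  | ClassZ => CN d
  end.

Lemma ler_of_sqr (a b : R) : 0 <= b -> a ^+ 2 <= b ^+ 2 -> a <= b.
Proof.
move=> b0 ab; have [//|ba] := leP a b; have a0 : 0 < a by lra.
by nra.
Qed.

Lemma in01_0 : in01 0. Proof. by split; lra. Qed.

Lemma in01_1 : in01 1. Proof. by split; lra. Qed.

(** The points chosen for different parameters fit together: the inequality at [g t], fed with those
    at [g s], gives [d (g s) (g t) ^+ 2 <= (s - t) ^+ 2 * d x y ^+ 2]. Equality follows, as the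
    three pieces of the curve have total length at least [d x y]. *)
Lemma CN_geodesic (T : Type) (d : T -> T -> R) (dP : pseudometric d) :
  CN d -> pseudo_class ClassG d.
Proof.
move=> cnT x y; have [d0 dC dD] := dP; have dge := pseudometric_ge0 dP.
have xyge := dge x y.
pose P t m := in01 t -> forall p, d p m ^+ 2 <=
  (1 - t) * d p x ^+ 2 + t * d p y ^+ 2 - t * (1 - t) * d x y ^+ 2.
have mP t : exists m, P t m.
  have [t01|nt] := pselect (in01 t).
    by have [m mt] := cnT x y t t01; exists m.
  by exists x => /nt.
(* The endpoints are prescribed, because in a pseudometric [CN] determines them only up to distance
   [0]. *)
pose g t := if t == 0 then x else if t == 1 then y else sval (cid (mP t)).
have gP t : P t (g t).
  rewrite /g; case: eqP => [->|_]; first by move=> _ p; lra.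
  by case: eqP => [->|_]; [move=> _ p; lra | exact: (svalP (cid (mP t)))].
have lip s t : in01 s -> in01 t -> d (g s) (g t) <= `|s - t| * d x y.
  move=> s01 t01; apply: ler_of_sqr; first by rewrite mulr_ge0.
  rewrite exprMn real_normK ?num_real//.
  have xs := gP s s01 x; have ys := gP s s01 y; have st := gP t t01 (g s).
  rewrite d0 in xs; rewrite d0 (dC y x) in ys.
  rewrite (dC _ x) (dC _ y) in st.
  case: s01 t01 => s0 s1 [t0 t1].
  set D := d x y ^+ 2 in xs ys st *.
  have xs' : (1 - t) * d x (g s) ^+ 2 <= (1 - t) * (s ^+ 2 * D).
    by apply: ler_wpM2l; lra.
  have ys' : t * d y (g s) ^+ 2 <= t * ((1 - s) ^+ 2 * D).
    by apply: ler_wpM2l; lra.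
  by lra.
exists g; split; first by rewrite /g eqxx.
split; first by rewrite /g eqxx oner_eq0.
move=> s t; wlog st : s t / s <= t.
  move=> wl s01 t01; have [/wl|/ltW/wl] := leP s t; first exact.
  by rewrite distrC dC; exact.
move=> s01 t01; apply/eqP; rewrite eq_le lip//=.
have x0 : g 0 = x by rewrite /g eqxx.
have y1 : g 1 = y by rewrite /g eqxx oner_eq0.
have := lip 0 s in01_0 s01; have := lip t 1 t01 in01_1.
rewrite x0 y1; have := dD x (g s) y; have := dD (g s) (g t) y.
case: s01 t01 => s0 s1 [t0 t1].
rewrite (ler0_norm (x := s - t)) ?(ler0_norm (x := t - 1)) ?(ler0_norm (x := 0 - s)); lra.
Qed.

Lemma geodesic_path (T : Type) (d : T -> T -> R) x y g :
  0 <= d x y -> geodesic d x y g -> is_path d g.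
Proof.
move=> xy0 [_ [_ gd]] s s01 e e0; exists (e / (d x y + 1)).
  by rewrite divr_gt0//; lra.
move=> t t01; rewrite ltr_pdivlMr; last lra.
by rewrite gd//; have := normr_ge0 (s - t); nra.
Qed.

(** Along the path [f] becomes a continuous function with values [0] and [1]; a change of value
    would make it reach [1 / 2]. *)
Lemma path_const (T : Type) (d : T -> T -> R) (f : T -> bool) (g : R -> T) :
  (forall x, exists2 e, 0 < e & forall y, d x y < e -> f x = f y) ->
  is_path d g -> f (g 0) = f (g 1).
Proof.
move=> fl gp.
(* Clamping to the unit interval extends the path to the whole line, where it is continuous. *)
pose cl (s : R) : R := if s < 0 then 0 else if 1 < s then 1 else s.
have cl01 s : in01 (cl s).
  by rewrite /cl /in01; case: (ltP s 0) => ?; [|case: (ltP 1 s) => ?]; lra.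
have cll (s t : R) : `|cl s - cl t| <= `|s - t|.
  have := ler_norm (s - t); have := ler_norm (t - s).
  rewrite (distrC t s) ler_norml /cl.
  case: (ltP s 0) => ?; [|case: (ltP 1 s) => ?];
    (case: (ltP t 0) => ?; [|case: (ltP 1 t) => ?]); lra.
pose h (s : R) : R := if f (g (cl s)) then 1 else 0.
have hc : continuous h.
  move=> s; apply: cvg_near_cst; apply/nbhs_ballP.
  have [e e0 fe] := fl (g (cl s)).
  have [del del0 gdel] := gp _ (cl01 s) e e0.
  exists del => //= t st; rewrite /h (fe (g (cl t)))//.
  by apply: gdel => //; apply: le_lt_trans (cll s t) _.
have cl0 : cl 0 = 0 by rewrite /cl ltxx ltr10.
have cl1 : cl 1 = 1 by rewrite /cl ltxx ltr10.
have [fne|] := eqVneq (f (g 0)) (f (g 1)); first by [].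
move=> fne.
have [| |c _] := @IVT _ h 0 1 (1 / 2) ler01.
- exact: continuous_subspaceT.
- rewrite /h cl0 cl1; move: fne; case: (f (g 0)); case: (f (g 1)) => // _.
    by rewrite min_r ?max_l//; apply/andP; split; lra.
  by rewrite min_l ?max_r//; apply/andP; split; lra.
- by rewrite /h; case: ifP => _; lra.
Qed.

(** Applied to the star, which thereby lies in all four classes at once. *)
Lemma CN_pseudo_class S (T : Type) (d : T -> T -> R) (dP : pseudometric d) :
  CN d -> pseudo_class S d.
Proof.
move=> cnT; have gT := CN_geodesic dP cnT.
have pT : pseudo_class ClassP d.
  move=> x y; have [g gg] := gT x y; exists g; split.
  - exact: geodesic_path (pseudometric_ge0 dP x y) gg.
  - by case: gg.
  - by case: gg => _ [].
case: S => //= f fl x y.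
by have [g [gp <- <-]] := pT x y; exact: path_const gp.
Qed.

(** * Comparison triangles and CAT(0) *)

Lemma eucl_sqr (a b : R * R) :
  eucl a b ^+ 2 = (a.1 - b.1) ^+ 2 + (a.2 - b.2) ^+ 2.
Proof. by rewrite sqr_sqrtr// addr_ge0// sqr_ge0. Qed.

Lemma eucl_ge0 (a b : R * R) : 0 <= eucl a b.
Proof. exact: sqrtr_ge0. Qed.

Lemma eucl_eq (a b : R * R) (r : R) : 0 <= r ->
  (a.1 - b.1) ^+ 2 + (a.2 - b.2) ^+ 2 = r ^+ 2 -> eucl a b = r.
Proof. by move=> r0 abr; rewrite /eucl abr sqrtr_sqr ger0_norm. Qed.

Lemma eucl_sym (a b : R * R) : eucl a b = eucl b a.
Proof. by rewrite /eucl; congr Num.sqrt; ring. Qed.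

(** With [P] at the origin and [Q] on the first axis, the law of cosines gives the first coordinate
    [u] of [S]. *)
Lemma comparison_triangle (a b c : R) : 0 <= a -> 0 <= b -> 0 <= c ->
  a <= b + c -> b <= a + c -> c <= a + b ->
  exists P Q S : R * R, [/\ eucl P Q = a, eucl Q S = b & eucl S P = c].
Proof.
move=> a0 b0 c0 abc bac cab.
have [a_eq0|a_neq0] := eqVneq a 0.
  have cb : c = b by lra.
  by exists (0, 0), (0, 0), (b, 0); split; apply: eucl_eq => //=; rewrite ?a_eq0 ?cb; ring.
have apos : 0 < a by rewrite lt_neqAle eq_sym a_neq0.
pose u := (a ^+ 2 + c ^+ 2 - b ^+ 2) / (2 * a).
have ua : u * (2 * a) = a ^+ 2 + c ^+ 2 - b ^+ 2.
  by rewrite /u divfK// mulf_neq0// pnatr_eq0.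
have uc : u ^+ 2 <= c ^+ 2.
  (* The two products are [b ^+ 2 - (c - a) ^+ 2] and [(c + a) ^+ 2 - b ^+ 2], non-negative by the
     triangle inequalities. *)
  have h : (c - u) * (2 * a) >= 0.
    by rewrite mulrBl ua; have : (b - (c - a)) * (b + (c - a)) >= 0; [apply: mulr_ge0; lra|lra].
  have h' : (c + u) * (2 * a) >= 0.
    by rewrite mulrDl ua; have : (c + a - b) * (c + a + b) >= 0; [apply: mulr_ge0; lra|lra].
  have : 0 <= (c - u) * (c + u).
    by apply: mulr_ge0; [move: h|move: h']; rewrite pmulr_lge0//; lra.
  by lra.
exists (0, 0), (a, 0), (u, Num.sqrt (c ^+ 2 - u ^+ 2)).
have ss : Num.sqrt (c ^+ 2 - u ^+ 2) ^+ 2 = c ^+ 2 - u ^+ 2.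
  by rewrite sqr_sqrtr//; lra.
by split; apply: eucl_eq => //=; [ring | rewrite sub0r sqrrN ss; lra |
  rewrite !subr0 ss; ring].
Qed.

Lemma lerp1 (a b : R * R) : lerp a b 1 = b.
Proof. by case: a b => [? ?] [? ?]; rewrite /lerp /=; congr pair; ring. Qed.

Lemma eucl_lerp_lerp (P Q : R * R) (s t : R) :
  eucl (lerp P Q s) (lerp P Q t) = `|s - t| * eucl P Q.
Proof.
apply: eucl_eq; first by rewrite mulr_ge0// eucl_ge0.
by rewrite exprMn real_normK ?num_real// eucl_sqr /=; ring.
Qed.

(** Comparing the distance from a vertex to a point of the opposite side suffices: in the plane the
    inequality is Stewart's identity. *)
Lemma CAT0_CN (X : CMS) : is_CAT0_ms X -> CN (@dist X).
Proof.
case=> gX catX x y t t01.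
have dP := dist_pseudometric X; have [d0 dC dD] := dP.
have dge := pseudometric_ge0 dP.
have [g gP] := gX x y; exists (g t) => p.
have [g2 g2P] := gX y p; have [g3 g3P] := gX p x.
have [|||P [Q [S [PQ QS SP]]]] :=
  comparison_triangle (dge x y) (dge y p) (dge p x).
1-3: have := dD x p y; have := dD y x p; have := dD p y x;
  rewrite (dC y x) (dC p y) (dC x p); lra.
(* The vertex [p] enters as the point with parameter [1] on side [1]. *)
have /= := catX _ _ _ _ _ _ gP g2P g3P P Q S PQ QS SP 1%N 0%N 1 t isT isT in01_1 t01.
rewrite lerp1; case: g2P => _ [-> _] pt.
have : dist p (g t) ^+ 2 <= eucl S (lerp P Q t) ^+ 2.
  by rewrite ler_pXn2r// nnegrE ?dge ?eucl_ge0.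
move/le_trans; apply.
by rewrite -SP (dC p y) -QS -PQ !eucl_sqr /=; lra.
Qed.

(** The point [m] given by [CN] is [g t] itself: for [p := g t] the right-hand side of the
    inequality is [0]. *)
Lemma CN_geodesic_point (X : CMS) (x y p : X) (g : R -> X) (t : R) :
  CN (@dist X) -> geodesic (@dist X) x y g -> in01 t ->
  dist p (g t) ^+ 2 <=
    (1 - t) * dist p x ^+ 2 + t * dist p y ^+ 2 - t * (1 - t) * dist x y ^+ 2.
Proof.
move=> cnX [g0 [g1 gd]] t01.
have dP := dist_pseudometric X; have [d0 dC dD] := dP.
have [m mP] := cnX x y t t01.
suff -> : g t = m by exact: mP.
have [dM _] := @dist_metric X; apply/dM/eqP.
have [t0 t1] := t01.
have gx : dist (g t) x = t * dist x y.
  by rewrite -{1}g0 gd ?subr0 ?ger0_norm//; exact: in01_0.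
have gy : dist (g t) y = (1 - t) * dist x y.
  by rewrite -{1}g1 (gd _ _ t01 in01_1) distrC ger0_norm ?subr_ge0.
have := mP (g t); rewrite gx gy !exprMn => h.
rewrite eq_le (pseudometric_ge0 dP) andbT.
by apply: ler_of_sqr => //; apply: le_trans h _; lra.
Qed.

(** The inequality is used along [g2] seen from [g1 s], then along [g1] seen from [r]; the Euclidean
    triangle has equality in both places. *)
Lemma CN_adjacent_sides (X : CMS) (p q r : X) (g1 g2 : R -> X) (s t : R)
  (P Q S : R * R) : CN (@dist X) ->
  geodesic (@dist X) p q g1 -> geodesic (@dist X) q r g2 ->
  eucl P Q = dist p q -> eucl Q S = dist q r -> eucl S P = dist r p ->
  in01 s -> in01 t ->
  dist (g1 s) (g2 t) <= eucl (lerp P Q s) (lerp Q S t).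
Proof.
move=> cnX gP1 gP2 PQ QS SP s01 t01.
have dP := dist_pseudometric X; have [d0 dC dD] := dP.
have h1 := CN_geodesic_point (g1 s) cnX gP2 t01.
have h2 := CN_geodesic_point r cnX gP1 s01.
have h3 : dist (g1 s) q = (1 - s) * dist p q.
  case: gP1 => _ [gq gd]; rewrite -{1}gq (gd _ _ s01 in01_1).
  by case: s01 => ? ?; rewrite distrC ger0_norm ?subr_ge0.
apply: ler_of_sqr; first exact: eucl_ge0.
apply: le_trans h1 _; rewrite h3 (dC (g1 s) r).
have h4 : t * dist r (g1 s) ^+ 2 <= t * ((1 - s) * dist r p ^+ 2 +
    s * dist r q ^+ 2 - s * (1 - s) * dist p q ^+ 2).
  by case: t01 => ? ?; exact: ler_wpM2l.
rewrite (dC r q) in h4.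
rewrite -PQ -QS -SP !exprMn !eucl_sqr in h4 *.
by rewrite /lerp /=; lra.
Qed.

Lemma CN_CAT0 (X : CMS) : CN (@dist X) -> is_CAT0_ms X.
Proof.
move=> cnX; have dP := dist_pseudometric X; have [d0 dC dD] := dP.
split; first exact: (CN_geodesic dP).
move=> p q r g1 g2 g3 G1 G2 G3 P Q S PQ QS SP side cside.
have same a b g A B s t : geodesic (@dist X) a b g -> eucl A B = dist a b ->
    in01 s -> in01 t -> dist (g s) (g t) <= eucl (lerp A B s) (lerp A B t).
  by move=> [_ [_ gd]] AB s01 t01; rewrite gd// eucl_lerp_lerp AB.
(* Nine pairs of sides: a side with itself gives an equality, the others are adjacent up to symmetry
   and cyclic relabelling. *)
move=> [|[|[|k]]] [|[|[|l]]] s t // _ _ s01 t01; rewrite /side /cside.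
- exact: same G1 PQ s01 t01.
- exact: CN_adjacent_sides G1 G2 PQ QS SP s01 t01.
- by rewrite dC eucl_sym; exact: CN_adjacent_sides G3 G1 SP PQ QS t01 s01.
- by rewrite dC eucl_sym; exact: CN_adjacent_sides G1 G2 PQ QS SP t01 s01.
- exact: same G2 QS s01 t01.
- exact: CN_adjacent_sides G2 G3 QS SP PQ s01 t01.
- exact: CN_adjacent_sides G3 G1 SP PQ QS s01 t01.
- by rewrite dC eucl_sym; exact: CN_adjacent_sides G2 G3 QS SP PQ t01 s01.
- exact: same G3 SP s01 t01.
Qed.

Lemma in_class_pseudo_class S (X : CMS) :
  in_class S X -> pseudo_class S (@dist X).
Proof.
case: S => //=; last exact: CAT0_CN.
move=> cX f fl x y; apply: contrapT => fxy.
have fo b : metric_open (@dist X) [set z | f z = b].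
  by move=> z /= <-; have [e e0 fe] := fl z; exists e; split=> // w /fe.
have [|||z [/= -> //]] := cX _ _ (fo true) (fo false).
- by move=> z /=; case: (f z); [left|right].
- by move: fxy; case fx : (f x); case fy : (f y) => // _; [exists x|exists y].
- by move: fxy; case fx : (f x); case fy : (f y) => // _; [exists y|exists x].
Qed.

(** * Metric quotients *)

(** Equal predicates receive equal witnesses, so a choice made in a class of points does not depend
    on how the class is described. *)
Lemma cid_ext (T : Type) (P Q : T -> Prop) (p : exists x, P x) (q : exists x, Q x) :
  P = Q -> sval (cid p) = sval (cid q).
Proof. by move=> PQ; case: _ / PQ q => q; rewrite (Prop_irrelevance p q). Qed.

(** The quotient is realised as the set of fixed points of a map [r] choosing one representative
    among the points at distance [0]. *)
Lemma metric_quotient (T : Type) (d : T -> T -> R) (t0 : T) :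
  pseudometric d -> ultra_compact d ->
  exists (Q : CMS) (pi : T -> Q), (forall q, exists t, pi t = q) /\
    forall x y, dist (pi x) (pi y) = d x y.
Proof.
move=> dP /(metric_compact_ultraP dP) cT; have [d0 dC dD] := dP.
have r_ex x : exists y, d x y = 0 by exists x.
pose r (x : T) : T := sval (cid (r_ex x)).
have rP x : d x (r x) = 0 by exact: (svalP (cid (r_ex x))).
have dr x y : d (r x) (r y) = d x y.
  have := pseudometric_dist2 dP (r x) (r y) x y.
  by rewrite (dC (r x) x) (dC (r y) y) !rP addr0 normr_le0 subr_eq0 => /eqP.
have r_eq x y : d x y = 0 -> r x = r y.
  move=> xy; apply: cid_ext; apply: funext => z; apply/propext; split=> h;
    apply/eqP; rewrite eq_le (pseudometric_ge0 dP) andbT.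
  - by rewrite (le_trans (dD y x z))// dC xy h addr0.
  - by rewrite (le_trans (dD x y z))// xy h addr0.
have rr x : r (r x) = r x by apply: r_eq; rewrite dC.
pose Q : Type := {x | r x = x}.
pose pi x : Q := exist _ (r x) (rr x).
have pi_surj q : exists t, pi t = q.
  by case: q => q rq; exists q; exact: eq_exist.
pose e (p q : Q) := d (sval p) (sval q).
have eM : is_metric e.
  split=> [[x rx] [y ry]|]; last by split=> *; [exact: dC|exact: dD].
  split=> [/r_eq xy|/(congr1 sval) /= xy]; last by rewrite /e /= xy.
  by apply: eq_exist; rewrite -rx -ry.
have Q0 : inhabited Q by constructor; exact: pi t0.
have Qc : metric_compact e.
  move=> I U Uo Ucov; have [||l lP] := cT I (fun i x => U i (pi x)).
  - move=> i x /(Uo i)[a [a0 aU]]; exists a; split=> // y xy; apply: aU.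
    by rewrite /e /= dr.
  - by move=> x; exact: Ucov.
  by exists l => q; have [t <-] := pi_surj q; exact: lP.
exists (Build_CMS eM Q0 Qc), pi; split; first exact: pi_surj.
by move=> x y; exact: dr.
Qed.

Lemma quotient_in_class S (T : Type) (d : T -> T -> R) (Q : CMS) (pi : T -> Q) :
  (forall q, exists t, pi t = q) -> (forall x y, dist (pi x) (pi y) = d x y) ->
  pseudo_class S d -> in_class S Q.
Proof.
move=> pis pid; case: S => /= [cT|pT|gT|cnT].
- move=> U V Uo Vo UV [q Uq] [q' Vq']; apply: contrapT => /forallNP nUV.
  have [t tq] := pis q; have [t' tq'] := pis q'.
  have loc (W : set Q) x : metric_open (@dist Q) W -> W (pi x) ->
      exists2 e, 0 < e & forall y, d x y < e -> W (pi y).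
    by move=> Wo /Wo[e [e0 eW]]; exists e => // y xy; apply: eW; rewrite pid.
  have nUV' x : V (pi x) -> ~ U (pi x) by move=> Vx Ux; apply: (nUV (pi x)).
  (* A separation of [Q] into [U] and [V] would make the indicator of [U] locally constant but not
     constant. *)
  suff /cT/(_ t t') : forall x, exists2 e, 0 < e &
      forall y, d x y < e -> `[< U (pi x) >] = `[< U (pi y) >].
    by rewrite asboolT ?tq// asboolF//; apply: nUV'; rewrite tq'.
  move=> x; have [Ux|Vx] := UV (pi x).
    have [e e0 eU] := loc U x Uo Ux.
    by exists e => // y /eU Uy; rewrite !asboolT.
  have [e e0 eV] := loc V x Vo Vx.
  by exists e => // y /eV Vy; rewrite !asboolF//; exact: nUV'.
- move=> p q; have [x <-] := pis p; have [y <-] := pis q.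
  have [g [gp g0 g1]] := pT x y; exists (pi \o g); split=> /=; rewrite ?g0 ?g1//.
  move=> s s01 e e0; have [del del0 h] := gp s s01 e e0; exists del => // t t01 st.
  by rewrite pid; exact: h.
- move=> p q; have [x <-] := pis p; have [y <-] := pis q.
  have [g [g0 [g1 gd]]] := gT x y; exists (pi \o g); rewrite /geodesic /= g0 g1.
  by split=> //; split=> // s t s01 t01; rewrite !pid gd.
- apply: CN_CAT0 => p q t t01; have [x <-] := pis p; have [y <-] := pis q.
  have [m mP] := cnT x y t t01; exists (pi m) => z; have [w <-] := pis z.
  by rewrite !pid.
Qed.

(** * Scaling and l2-products *)

Section l2.
Variable I : finType.
Implicit Types a b : I -> R.

Definition l2norm a : R := Num.sqrt (\sum_i a i ^+ 2).

Lemma l2norm_ge0 a : 0 <= l2norm a.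
Proof. exact: sqrtr_ge0. Qed.

Lemma sum_sqr_ge0 a : 0 <= \sum_i a i ^+ 2.
Proof. by apply: sumr_ge0 => i _; exact: sqr_ge0. Qed.

Lemma sqr_l2norm a : l2norm a ^+ 2 = \sum_i a i ^+ 2.
Proof. by rewrite sqr_sqrtr// sum_sqr_ge0. Qed.

Lemma cauchy_schwarz_sum a b :
  (\sum_i a i * b i) ^+ 2 <= (\sum_i a i ^+ 2) * (\sum_i b i ^+ 2).
Proof.
set A := \sum_i a i ^+ 2; set B := \sum_i b i ^+ 2; set C := \sum_i a i * b i.
have [B0|B_neq0] := eqVneq B 0.
  have b0 i : b i = 0.
    have /eqP : b i ^+ 2 = 0 by exact: (psumr_eq0P (fun i _ => sqr_ge0 (b i)) B0).
    by rewrite sqrf_eq0 => /eqP.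
  by rewrite B0 mulr0 /C big1 ?expr0n// => i _; rewrite b0 mulr0.
have Bpos : 0 < B by rewrite lt_neqAle eq_sym B_neq0 sum_sqr_ge0.
have : 0 <= \sum_i (B * a i - C * b i) ^+ 2 by exact: sum_sqr_ge0.
have -> : \sum_i (B * a i - C * b i) ^+ 2 = B * (A * B - C ^+ 2).
  rewrite (eq_bigr (fun i => B ^+ 2 * a i ^+ 2 - 2 * B * C * (a i * b i)
    + C ^+ 2 * b i ^+ 2)); last by move=> i _; ring.
  by rewrite big_split sumrB -!mulr_sumr -/A -/B -/C /=; ring.
by rewrite pmulr_rge0// subr_ge0.
Qed.

Lemma l2norm_triangle a b : l2norm (fun i => a i + b i) <= l2norm a + l2norm b.
Proof.
apply: ler_of_sqr; first by rewrite addr_ge0// l2norm_ge0.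
have ab : \sum_i a i * b i <= l2norm a * l2norm b.
  apply: ler_of_sqr; first by rewrite mulr_ge0// l2norm_ge0.
  by rewrite exprMn !sqr_l2norm cauchy_schwarz_sum.
rewrite sqrrD !sqr_l2norm.
have -> : \sum_i (a i + b i) ^+ 2 =
    \sum_i a i ^+ 2 + 2 * \sum_i a i * b i + \sum_i b i ^+ 2.
  by rewrite mulr_sumr -!big_split; apply: eq_bigr => i _ /=; ring.
by lra.
Qed.

Lemma ler_l2norm a b : (forall i, `|a i| <= `|b i|) -> l2norm a <= l2norm b.
Proof.
move=> ab; rewrite /l2norm ler_wsqrtr// ler_sum// => i _.
by rewrite -(real_normK (num_real (a i))) -(real_normK (num_real (b i))) ler_pXn2r.
Qed.

Lemma ler_component_l2norm a i : `|a i| <= l2norm a.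
Proof.
apply: ler_of_sqr; first exact: l2norm_ge0.
rewrite real_normK ?num_real// sqr_l2norm (bigD1 i)//= lerDl.
by apply: sumr_ge0 => j _; exact: sqr_ge0.
Qed.

Lemma l2norm_le_sum a : l2norm a <= \sum_i `|a i|.
Proof.
apply: ler_of_sqr; first by apply: sumr_ge0.
rewrite sqr_l2norm.
pose P (u v : R) := 0 <= v /\ u <= v ^+ 2.
suff [] : P (\sum_i a i ^+ 2) (\sum_i `|a i|) by [].
apply: (big_ind2 P) => [|u v u' v' [v0 uv] [v0' uv']|i _].
- by split=> //; rewrite expr0n.
- by split; [exact: addr_ge0|rewrite sqrrD; have := mulr_ge0 v0 v0'; lra].
- by split=> //; rewrite real_normK ?num_real.
Qed.

Lemma l2norm0 : l2norm (fun=> 0) = 0.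
Proof. by rewrite /l2norm big1 ?sqrtr0// => i _; rewrite expr0n. Qed.

Lemma l2norm_dist a b : `|l2norm a - l2norm b| <= \sum_i `|a i - b i|.
Proof.
have half a' b' : l2norm a' - l2norm b' <= \sum_i `|a' i - b' i|.
  rewrite lerBlDl; apply: (le_trans _ (lerD (lexx _) (l2norm_le_sum _))).
  apply: le_trans (l2norm_triangle _ _).
  by apply: ler_l2norm => i; rewrite subrKC.
rewrite ler_norml half andbT lerNl opprB (le_trans (half b a))//.
by rewrite ler_sum// => i _; rewrite distrC.
Qed.

Variables (T : I -> Type).
Implicit Types d : forall i, T i -> T i -> R.

Definition l2_dist d (x y : forall i, T i) : R := l2norm (fun i => d i (x i) (y i)).

Lemma l2_dist_pseudometric d :
  (forall i, pseudometric (@d i)) -> pseudometric (l2_dist d).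
Proof.
move=> dP; split=> [x|x y|x y z].
- rewrite /l2_dist -[RHS]l2norm0; congr l2norm; apply: funext => i.
  by case: (dP i) => ->.
- by rewrite /l2_dist; congr l2norm; apply: funext => i; case: (dP i) => _ ->.
- apply: le_trans (l2norm_triangle _ _); apply: ler_l2norm => i.
  have dge := pseudometric_ge0 (dP i).
  by rewrite !ger0_norm ?addr_ge0//; case: (dP i).
Qed.

(** The denominator [#|I|.+1] makes the final bound strict and covers an empty [I]. *)
Lemma l2_dist_lt d (x y : forall i, T i) e :
  (forall i, pseudometric (@d i)) ->
  0 < e -> (forall i, d i (x i) (y i) < e / (#|I|.+1)%:R) -> l2_dist d x y < e.
Proof.
move=> dP e0 xye; apply: le_lt_trans (l2norm_le_sum _) _.
apply: (@le_lt_trans _ _ (\sum_(i : I) e / (#|I|.+1)%:R)).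
  by apply: ler_sum => i _; rewrite ger0_norm ?(pseudometric_ge0 (dP i))// ltW.
rewrite sumr_const -[X in X < _]mulr_natl mulrCA gtr_pMr// ltr_pdivrMr// mul1r ltr_nat//.
Qed.

Lemma l2_dist_ultra_compact d :
  (forall i, pseudometric (@d i)) ->
  (forall i, ultra_compact (@d i)) -> ultra_compact (l2_dist d).
Proof.
move=> dP dc F FU; have FP := @ultra_proper _ _ FU.
have lim i : exists x : T i, forall e, 0 < e -> F [set f | d i x (f i) < e].
  (* The image of [F] under a coordinate is refined to an ultrafilter with limit [x]; as [F] is
     itself ultra, the preimages of balls around [x] belong to [F]. *)
  pose G : set_system (T i) := [set A | F [set f | A (f i)]].
  have GP : ProperFilter G.
    split; first by move=> /filter_ex[].
    split; [exact: filterT|by move=> A B; exact: filterI|].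
    by move=> A B AB; apply: filterS => f; exact: AB.
  have [G' [GU GG']] := ultraFilterLemma GP.
  have [x xP] := dc i G' GU; exists x => e e0.
  have [//|nF] := in_ultra_setVsetC [set f : forall i, T i | d i x (f i) < e] FU.
  have /GG' nG : G (~` [set y | d i x y < e]) by [].
  have GP' := @ultra_proper _ _ GU.
  by have [y []] := filter_ex (filterI (xP e e0) nG).
exists (fun i => sval (cid (lim i))) => e e0.
have : F [set f | forall i, d i (sval (cid (lim i))) (f i) < e / (#|I|.+1)%:R].
  by apply: filter_forall => i; apply: (svalP (cid (lim i))); rewrite divr_gt0.
by apply: filterS => f; exact: l2_dist_lt.
Qed.

(** Witnesses are combined coordinatewise; the geodesic equation and [CN] concern squares of
    distances and are summed. For connectedness, [f] is unchanged when one coordinate moves, and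
    finitely many moves lead from [x] to [y]. *)
Lemma l2_dist_class S d :
  (forall i, pseudometric (@d i)) -> (forall i, pseudo_class S (@d i)) ->
  pseudo_class S (l2_dist d).
Proof.
move=> dP; case: S => /= dS.
- move=> f fl.
  have step x i (u v : T i) : f (dfwith x i u) = f (dfwith x i v).
    apply: (dS i (fun w => f (dfwith x i w))) => w.
    have [e e0 fe] := fl (dfwith x i w); exists e => // w' ww'; apply: fe.
    apply: le_lt_trans (l2norm_le_sum _) _.
    rewrite (bigD1 i)//= !dfwithin ger0_norm ?(pseudometric_ge0 (dP i))//.
    rewrite big1 ?addr0// => j ji; rewrite !dfwithout 1?eq_sym//.
    by case: (dP j) => -> _ _; rewrite normr0.
  have self (x : forall i, T i) i : dfwith x i (x i) = x.
    by apply: functional_extensionality_dep => j; case: dfwithP.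
  suff seqP (s : seq I) x y : (forall i, i \notin s -> x i = y i) -> f x = f y.
    by move=> x y; apply: (seqP (enum I)) => i; rewrite mem_enum.
  elim: s x => [|i s IHs] x xy.
    by congr f; apply: functional_extensionality_dep => i; exact: xy.
  rewrite -{1}(self x i) (step x i (x i) (y i)); apply: IHs => j.
  case: dfwithP => [//|k ik ks]; apply: xy.
  by rewrite inE negb_or eq_sym ik.
- move=> x y; pose g s i := sval (cid (dS i (x i) (y i))) s.
  have gP i := svalP (cid (dS i (x i) (y i))).
  exists g; split; last 2 first.
  + by apply: functional_extensionality_dep => i; case: (gP i).
  + by apply: functional_extensionality_dep => i; case: (gP i).
  move=> s s01 e e0; pose e' := e / (#|I|.+1)%:R.
  have e'0 : 0 < e' by rewrite divr_gt0.
  have delP i : exists del : R, 0 < del /\ forall t, in01 t ->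
      `|s - t| < del -> d i (g s i) (g t i) < e'.
    by have [gp _ _] := gP i; have [del ? ?] := gp s s01 e' e'0; exists del.
  exists (\big[Num.min/1]_i sval (cid (delP i))).
    by apply: lt_bigmin => // i _; case: (svalP (cid (delP i))).
  move=> t t01 st; apply: l2_dist_lt => // i.
  have [_] := svalP (cid (delP i)); apply => //; apply: lt_le_trans st _.
  exact: bigmin_le.
- move=> x y; pose g s i := sval (cid (dS i (x i) (y i))) s.
  have gP i := svalP (cid (dS i (x i) (y i))).
  exists g; split; [|split].
  + by apply: functional_extensionality_dep => i; case: (gP i).
  + by apply: functional_extensionality_dep => i; case: (gP i) => _ [].
  move=> s t s01 t01; rewrite /l2_dist.
  apply/eqP; rewrite -(eqrXn2 (n := 2))// ?mulr_ge0 ?l2norm_ge0//.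
  rewrite exprMn !sqr_l2norm mulr_sumr; apply/eqP/eq_bigr => i _.
  by case: (gP i) => _ [_ gd]; rewrite gd// exprMn.
- move=> x y t t01; exists (fun i => sval (cid (dS i (x i) (y i) t t01))) => p.
  rewrite !sqr_l2norm !mulr_sumr -sumrN -!big_split /=; apply: ler_sum => i _.
  exact: (svalP (cid (dS i (x i) (y i) t t01))).
Qed.

End l2.

Section scaling.
Variables (T : Type) (d : T -> T -> R) (c : R).
Hypotheses (dP : pseudometric d) (c01 : in01 c).

(** The factor [c] may be [0], which collapses the space; hence pseudometrics throughout. *)
Lemma scale_pseudometric : pseudometric (fun x y => c * d x y).
Proof.
case: dP c01 => d0 dC dD [c0 c1].
split=> [x|x y|x y z]; first by rewrite d0 mulr0.
  by rewrite (dC x).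
by rewrite -mulrDr ler_wpM2l.
Qed.

Lemma scale_le x y : c * d x y <= d x y.
Proof. by case: c01 => c0 c1; rewrite ler_piMl// (pseudometric_ge0 dP). Qed.

Lemma scale_ultra_compact : ultra_compact d -> ultra_compact (fun x y => c * d x y).
Proof.
move=> cT F FU; have [x xP] := cT F FU; have FP := @ultra_proper _ _ FU.
by exists x => e /xP; apply: filterS => y; apply: le_lt_trans (scale_le x y).
Qed.

Lemma scale_class S : pseudo_class S d -> pseudo_class S (fun x y => c * d x y).
Proof.
have [c0 c1] := c01; case: S => /= dS.
- move=> f fl; apply: dS => x; have [e e0 fe] := fl x; exists e => // y xy.
  by apply: fe; apply: le_lt_trans xy; exact: scale_le.
- move=> x y; have [g [gp g0 g1]] := dS x y; exists g; split=> // s s01 e e0.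
  have [del del0 h] := gp s s01 e e0; exists del => // t t01 st.
  by apply: le_lt_trans (h t t01 st); exact: scale_le.
- move=> x y; have [g [g0 [g1 gd]]] := dS x y; exists g; split=> //; split=> //.
  by move=> s t s01 t01; rewrite gd//; ring.
- move=> x y t t01; have [m mP] := dS x y t t01; exists m => p.
  have := ler_wpM2l (sqr_ge0 c) (mP p); lra.
Qed.

End scaling.

(** * Stars *)

Definition unit_interval : Type := {r : R | in01 r}.

Section star.

(* The star with legs [q : nat] of lengths [a q], the point [(q, r)] lying at
   distance [a q * r] from the centre. *)
Definition star_pos (a : nat -> R) (x : nat * unit_interval) : R := a x.1 * sval x.2.

Definition star_dist (a : nat -> R) (x y : nat * unit_interval) : R :=
  if x.1 == y.1 then `|star_pos a x - star_pos a y| else star_pos a x + star_pos a y.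

Variable a : nat -> R.
Hypothesis a0 : forall q, 0 <= a q.

Lemma star_pos_ge0 x : 0 <= star_pos a x.
Proof. by rewrite mulr_ge0//; case: (svalP x.2). Qed.

Lemma star_pseudometric : pseudometric (star_dist a).
Proof.
split=> [x|x y|x y z]; rewrite /star_dist.
- by rewrite eqxx subrr normr0.
- by rewrite eq_sym; case: ifP => _; [rewrite distrC|rewrite addrC].
have := star_pos_ge0 x; have := star_pos_ge0 y; have := star_pos_ge0 z.
case: (eqVneq x.1 y.1) => [->|xy].
  case: eqVneq => [_|_] ? ? ?; first exact: ler_distD.
  by have := ler_norm (star_pos a x - star_pos a y); lra.
case: (eqVneq y.1 z.1) => [<-|yz].
  rewrite (negbTE xy) => ? ? ?.
  by have := ler_norm (star_pos a z - star_pos a y); rewrite distrC; lra.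
case: eqVneq => [_|_] ? ? ?; last lra.
by rewrite (le_trans (ler_normB _ _))// !ger0_norm//; lra.
Qed.

Lemma star_leg_point (x : nat * unit_interval) w : 0 <= w -> w <= star_pos a x ->
  exists2 m : nat * unit_interval, m.1 = x.1 & star_pos a m = w.
Proof.
case: x => q [r [r0 r1]]; rewrite /star_pos /= => w0 wr.
have [aq0|aq] := eqVneq (a q) 0.
  exists (q, exist _ 0 in01_0) => //=; rewrite aq0; rewrite aq0 in wr; lra.
have aqp : 0 < a q by rewrite lt_neqAle eq_sym aq a0.
have h : in01 (w / a q).
  split; first by rewrite divr_ge0.
  rewrite ler_pdivrMr// mul1r; apply: le_trans wr _.
  by rewrite ler_piMr.
by exists (q, exist _ _ h) => //=; rewrite mulrC divfK.
Qed.

(** Two legs form an interval of the line, where weighted means give equality. For [x] and [y] on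
    different legs, a point [p] on a third leg only makes the right-hand side larger. *)
Lemma star_CN : CN (star_dist a).
Proof.
move=> x y t [t0 t1].
have px := star_pos_ge0 x; have py := star_pos_ge0 y.
set u := star_pos a x in px; set v := star_pos a y in py.
have tu : 0 <= (1 - t) * u by apply: mulr_ge0; lra.
have tv : 0 <= t * v by apply: mulr_ge0.
have sqn (z : R) : `|z| ^+ 2 = z ^+ 2 by rewrite real_normK ?num_real.
have [xy|xy] := eqVneq x.1 y.1.
  have [m mx mP] : exists2 m : nat * unit_interval, m.1 = x.1 &
      star_pos a m = (1 - t) * u + t * v.
    have [uv|/ltW vu] := leP u v.
      have [|m my mP] := @star_leg_point y ((1 - t) * u + t * v) (addr_ge0 tu tv).
        by rewrite -/v; have : (1 - t) * (v - u) >= 0 by [apply: mulr_ge0; lra]; lra.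
      by exists m; rewrite ?my.
    have [|m my mP] := @star_leg_point x ((1 - t) * u + t * v) (addr_ge0 tu tv).
      by rewrite -/u; have : t * (u - v) >= 0 by [apply: mulr_ge0; lra]; lra.
    by exists m.
  exists m => p; rewrite /star_dist mx mP -/u -/v -xy eqxx.
  by case: ifP => _; rewrite !sqn; lra.
(* The sign tells on which of the two legs [m] lies. *)
have [w0|/ltW w0] := leP 0 ((1 - t) * u - t * v).
  have [|m mx mP] := @star_leg_point x _ w0.
    by rewrite -/u; have : 0 <= t * u by [exact: mulr_ge0]; lra.
  exists m => p; rewrite /star_dist mx mP -/u -/v (negbTE xy).
  have [->|px'] := eqVneq p.1 x.1; first by rewrite (negbTE xy) !sqn; lra.
  have pp := mulr_ge0 (star_pos_ge0 p) tv.
  by case: ifP => _; rewrite ?sqn; lra.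
have [||m my mP] := @star_leg_point y (t * v - (1 - t) * u).
- lra.
- by rewrite -/v; have : 0 <= (1 - t) * v by [apply: mulr_ge0; lra]; lra.
exists m => p; rewrite /star_dist my mP -/u -/v (negbTE xy).
have [->|py'] := eqVneq p.1 y.1; first by rewrite eq_sym (negbTE xy) !sqn; lra.
have pp := mulr_ge0 (star_pos_ge0 p) tu.
by case: ifP => _; rewrite ?sqn; lra.
Qed.

(** An ultrafilter either tends to the centre or, as only finitely many legs are long, lives on a
    single leg, where it converges as in an interval. *)
Lemma star_ultra_compact :
  (forall e, 0 < e -> exists m, forall q, (m <= q)%N -> a q < e) ->
  ultra_compact (star_dist a).
Proof.
move=> a_lim F FU; have FP := @ultra_proper _ _ FU.
have [to0|] := pselect (forall e, 0 < e -> F [set x | star_pos a x < e]).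
  exists (0%N, exist _ 0 in01_0) => e /to0; apply: filterS => y /= ye.
  rewrite /star_dist /star_pos /= mulr0 sub0r add0r normrN.
  by rewrite ger0_norm ?star_pos_ge0// if_same.
move=> /existsNP[e /not_implyP[e0 nF]].
have [m am] := a_lim e e0.
have [k Fk] : exists k, F [set x : nat * unit_interval | x.1 = k].
  have [|k [_ Fk]] := list_In_union_ultra
      (U := fun k => [set x : nat * unit_interval | x.1 = k]) (l := iota 0 m) FU.
    have [//|] := in_ultra_setVsetC [set x | star_pos a x < e] FU.
    apply: filterS => x /= /negP; rewrite -leNgt => ex; exists x.1; split=> //.
    have xm : (x.1 < m)%N.
      rewrite ltnNge; apply/negP => /am; apply/negP; rewrite -leNgt.
      apply: le_trans ex _; rewrite /star_pos ler_piMr//.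
      by case: (svalP x.2).
    have : x.1 \in iota 0 m by rewrite mem_iota.
    elim: (iota 0 m) => //= j s IHs; rewrite inE => /orP[/eqP->|]; first by left.
    by move/IHs; right.
  by exists k.
(* The limit coordinate is the supremum of the lower bounds valid on a member of [F]. *)
pose E : set R := [set r | F [set x : nat * unit_interval | r <= sval x.2]].
have E0 : E 0 by apply: filterS filterT => x _; case: (svalP x.2).
have E1 : ubound E 1.
  by move=> r /filter_ex[x /= /le_trans]; apply; case: (svalP x.2).
have Es : has_sup E by split; [exists 0|exists 1].
have c01 : in01 (sup E).
  split; first by apply: ub_le_sup => //; exists 1.
  by apply: ge_sup => //; exists 0.
exists (k, exist _ _ c01) => h h0.
have ak : 0 < a k + 1 by have := a0 k; lra.
pose h' := h / (a k + 1); have h'0 : 0 < h' by rewrite divr_gt0.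
have [r Er hr] := sup_adherent h'0 Es.
have nE : ~ E (sup E + h').
  by move=> /(ub_le_sup (ex_intro _ 1 E1)); rewrite gerDl leNgt h'0.
have [//|Fh] := in_ultra_setVsetC [set x : nat * unit_interval | sup E + h' <= sval x.2] FU.
have Er' : F [set x : nat * unit_interval | r <= sval x.2] := Er.
apply: filterS (filterI Fk (filterI Er' Fh)) => y /= [yk [ry /negP]].
rewrite -ltNge => yc; rewrite /star_dist /star_pos /= yk eqxx -mulrBr normrM (ger0_norm (a0 k)).
apply: (@le_lt_trans _ _ (a k * h')).
  by rewrite ler_wpM2l// ler_norml; lra.
rewrite /h' mulrA ltr_pdivrMr//; lra.
Qed.

End star.

Lemma star_pos_dist (a b : nat -> R) eta x : 0 <= eta ->
  (forall q, `|a q - b q| <= eta) -> `|star_pos a x - star_pos b x| <= eta.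
Proof.
move=> eta0 ab; rewrite /star_pos -mulrBl normrM.
have [r0 r1] := svalP x.2; rewrite (ger0_norm r0).
by have := ab x.1; have := normr_ge0 (a x.1 - b x.1); nra.
Qed.

Lemma star_dist_lip (a b : nat -> R) eta x y : 0 <= eta ->
  (forall q, `|a q - b q| <= eta) ->
  `|star_dist a x y - star_dist b x y| <= 2 * eta.
Proof.
move=> eta0 ab; have hx := star_pos_dist x eta0 ab; have hy := star_pos_dist y eta0 ab.
rewrite /star_dist; case: ifP => _.
  apply: le_trans (ler_dist_dist _ _) _.
  by move: hx hy; rewrite !ler_norml; lra.
by move: hx hy; rewrite !ler_norml; lra.
Qed.

(** Legs not dominated by [b] are short; forgetting them costs at most [eta] at each of the two
    points. *)
Lemma star_dist_le (a b : nat -> R) eta x y : 0 <= eta ->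
  (forall q, 0 <= a q) -> (forall q, 0 <= b q) ->
  (forall q, a q <= b q \/ a q <= eta) ->
  star_dist a x y <= star_dist b x y + 2 * eta.
Proof.
move=> eta0 a0 b0 ab.
have pos_le z : star_pos a z <= star_pos b z + eta.
  have [r0 r1] := svalP z.2; rewrite /star_pos.
  by have := b0 z.1; have := a0 z.1; case: (ab z.1) => ? ? ?; nra.
rewrite /star_dist; case: eqVneq => [xy|_]; last first.
  by have := pos_le x; have := pos_le y; lra.
rewrite /star_pos -xy -!mulrBr !normrM (ger0_norm (a0 _)) (ger0_norm (b0 _)).
set u := `|_ - _|; have u0 : 0 <= u by exact: normr_ge0.
have u1 : u <= 1.
  by have [? ?] := svalP x.2; have [? ?] := svalP y.2; rewrite ler_norml; lra.
case: (ab x.1) => [h|h]; first by have := ler_wpM2r u0 h; lra.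
have := ler_pM (a0 x.1) u0 h u1; have := mulr_ge0 (b0 x.1) u0; lra.
Qed.

(** * Products with a star *)

(** Level [k] consists of the legs from [N k] up to [N k.+1], and [lev q] is the level of leg [q].
    The size of level [k] is fixed after [N k], so it may depend on a covering number of what the
    earlier levels span. *)
Lemma levels (Q : nat -> nat -> nat) : exists N lev : nat -> nat,
  (forall k, (Q k (N k) < N k.+1)%N) /\ forall k q, (N k <= q)%N = (k <= lev q)%N.
Proof.
pose N := fix N k := if k is k'.+1 then (Q k' (N k') + N k').+1 else 0%N.
have N_lt k : (N k < N k.+1)%N by rewrite /= ltnS leq_addl.
have N_mono : {homo N : k l / (k <= l)%N}.
  by apply: homo_leq => [k|k l m|k]; [exact: leqnn|exact: leq_trans|exact: ltnW].
have N_ge k : (k <= N k)%N by elim: k => // k IHk; exact: leq_ltn_trans (N_lt k).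
have N0 q : exists k, (N k <= q)%N by exists 0%N.
have N_bound q k : (N k <= q)%N -> (k <= q)%N by exact: leq_trans.
exists N, (fun q => ex_maxn (N0 q) (N_bound q)); split=> [k|k q].
  by rewrite /= ltnS leq_addr.
case: ex_maxnP => l Nl lmax; apply/idP/idP; first exact: lmax.
by move=> /N_mono kl; exact: leq_trans kl Nl.
Qed.

Section weighted_product.
Variables (I : finType) (X : I -> CMS).
Implicit Types (z : I -> R) (a b : nat -> R) (e eta : R).

Definition factor (o : option I) : Type :=
  if o is Some i then car (X i) else (nat * unit_interval)%type.

Definition factor_dist (z : I -> R) (a : nat -> R) (o : option I) :
    factor o -> factor o -> R :=
  match o with
  | Some i => fun x y => z i * dist x y
  | None => star_dist a
  end.

Definition product_dist (z : I -> R) (a : nat -> R) :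
    (forall o, factor o) -> (forall o, factor o) -> R :=
  l2_dist (factor_dist z a).

Definition admissible (z : I -> R) (a : nat -> R) : Prop :=
  [/\ forall i, in01 (z i), forall q, 0 <= a q &
      forall e, 0 < e -> exists m, forall q, (m <= q)%N -> a q < e].

Lemma factor_dist_pseudometric z a o :
  admissible z a -> pseudometric (@factor_dist z a o).
Proof.
case=> z01 a0 _; case: o => [i|]; last exact: star_pseudometric.
exact: scale_pseudometric (dist_pseudometric _) (z01 i).
Qed.

Lemma product_dist_pseudometric z a :
  admissible z a -> pseudometric (product_dist z a).
Proof.
by move=> za; apply: l2_dist_pseudometric => o; exact: factor_dist_pseudometric.
Qed.

Lemma product_dist_ultra_compact z a :
  admissible z a -> ultra_compact (product_dist z a).
Proof.
move=> za; have [z01 a0 al] := za; apply: l2_dist_ultra_compact => o.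
  exact: factor_dist_pseudometric.
case: o => [i|]; last exact: star_ultra_compact.
apply: scale_ultra_compact (dist_pseudometric _) (z01 i) _.
by apply/(metric_compact_ultraP (dist_pseudometric _)); exact: car_compact.
Qed.

Lemma product_dist_class S z a : (forall i, in_class S (X i)) ->
  admissible z a -> pseudo_class S (product_dist z a).
Proof.
move=> XS za; have [z01 a0 al] := za; apply: l2_dist_class => o.
  exact: factor_dist_pseudometric.
case: o => [i|] /=; last exact: CN_pseudo_class (star_pseudometric a0) (star_CN a0).
by apply: scale_class (dist_pseudometric _) (z01 i) _ _; exact: in_class_pseudo_class.
Qed.

Lemma product_dist_lip z a z' a' B e x y : 0 <= e ->
  (forall i (u w : X i), dist u w <= B) ->
  (forall i, `|z i - z' i| * B <= e) -> (forall q, 2 * `|a q - a' q| <= e) ->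
  `|product_dist z a x y - product_dist z' a' x y| <= #|{: option I}|%:R * e.
Proof.
move=> e0 XB ze ae; apply: le_trans (l2norm_dist _ _) _.
rewrite mulr_natl -sumr_const; apply: ler_sum => -[i|] _ /=.
  rewrite -mulrBl normrM (ger0_norm (pseudometric_ge0 (dist_pseudometric _) _ _)).
  by apply: le_trans (ze i); rewrite ler_wpM2l.
apply: le_trans (@star_dist_lip _ _ (e / 2) _ _ _ _) _; first lra.
  by move=> q; have := ae q; lra.
lra.
Qed.

(** Apart from [eta], the right-hand side involves neither [z] nor [a], so one covering number
    serves the whole family. *)
Lemma product_dist_le z a b eta x y : 0 <= eta ->
  (forall i, in01 (z i)) -> (forall q, 0 <= a q) -> (forall q, 0 <= b q) ->
  (forall q, a q <= b q \/ a q <= eta) ->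
  product_dist z a x y <= product_dist (fun=> 1) b x y + 2 * eta.
Proof.
move=> eta0 z01 a0 b0 ab.
(* The error is carried by the star factor alone. *)
pose h (o : option I) : R := if o is None then 2 * eta else 0.
have hsum : l2norm h <= 2 * eta.
  apply: le_trans (l2norm_le_sum _) _; rewrite (bigD1 None)//= big1.
    by rewrite addr0 ger0_norm//; lra.
  by case=> //= i _; rewrite normr0.
apply: le_trans (lerD (lexx _) hsum); apply: le_trans (l2norm_triangle _ _).
apply: ler_l2norm => -[i|] /=.
  have d0 := pseudometric_ge0 (dist_pseudometric (X i)) (x (Some i)) (y (Some i)).
  have [z0 z1] := z01 i.
  by rewrite addr0 mul1r !ger0_norm ?mulr_ge0// ler_piMl.
have da := pseudometric_ge0 (star_pseudometric a0) (x None) (y None).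
have db := pseudometric_ge0 (star_pseudometric b0) (x None) (y None).
by rewrite !ger0_norm//; [exact: star_dist_le|lra].
Qed.

Definition tip (t : forall i, X i) (q : nat) (o : option I) : factor o :=
  match o with
  | Some i => t i
  | None => (q, exist _ 1 in01_1)
  end.

Lemma product_dist_tip z a t q q' : (forall q, 0 <= a q) -> q != q' ->
  a q + a q' <= product_dist z a (tip t q) (tip t q').
Proof.
move=> a0 qq'; apply: le_trans (ler_component_l2norm _ None) => /=.
by rewrite /star_dist /star_pos /= (negbTE qq') !mulr1 ger0_norm// addr_ge0.
Qed.

End weighted_product.

(** Pigeonhole: of [N] points at mutual distance at least [A] in [Q], two correspond to points of
    the same class in [Q'], and a correspondence of arbitrarily small distortion compares the two
    distances. *)
Lemma pointwise_le_of_dGH0 (T : Type) (Q Q' : CMS) (d d' : T -> T -> R)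
  (pi : T -> Q) (pi' : T -> Q') (P N : nat) (u : nat -> T) (cl : T -> 'I_P) (A B : R) :
  (forall q, exists t, pi' t = q) ->
  (forall x y, dist (pi x) (pi y) = d x y) ->
  (forall x y, dist (pi' x) (pi' y) = d' x y) ->
  (P < N)%N ->
  (forall q q', (q < N)%N -> (q' < N)%N -> q != q' -> A <= d (u q) (u q')) ->
  (forall x y, cl x = cl y -> d' x y <= B) ->
  dGH Q Q' <= 0 -> A <= B.
Proof.
move=> pi's pid pid' PN uA clB QQ'.
apply/ler_addgt0Pr => e e0; have e2 : 0 < e / 2 by rewrite divr_gt0.
have [C [CX _ CC]] := dGH_lt_correspondence (le_lt_trans QQ' e2).
have uP q : exists t, C (pi (u q)) (pi' t).
  by have [p up] := CX (pi (u q)); have [t tp] := pi's p; exists t; rewrite tp.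
pose w q := sval (cid (uP q)).
have wP q : C (pi (u q)) (pi' (w q)) := svalP (cid (uP q)).
have /injectivePn[q [q' qq' ww']] : ~~ injectiveb (fun q : 'I_N => cl (w q)).
  apply/negP => /injectiveP /leq_card; rewrite !card_ord leqNgt; exact/negP/negPn.
have := CC _ _ _ _ (wP q) (wP q'); rewrite pid pid'.
have := uA q q' (ltn_ord q) (ltn_ord q') qq'.
by have := clB _ _ ww'; rewrite ler_norml; lra.
Qed.

(** * Weights and leg lengths *)

Lemma compact_metric_compact (H : topologicalType) (d : H -> H -> R) :
  is_metric d ->
  (forall (x : H) (U : set H),
     nbhs x U <-> exists e : R, 0 < e /\ forall y, d x y < e -> U y) ->
  compact [set: H] -> metric_compact d.
Proof.
move=> dM dnbhs Hc; apply/(metric_compact_ultraP (is_metric_pseudometric dM)) => F FU.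
move: Hc; rewrite compact_ultra => /(_ F FU filterT)[x [_ Fx]].
by exists x => e e0; apply: Fx; apply/dnbhs; exists e.
Qed.

(** Arbitrarily late visits are required because the leg of level [k] is recovered only up to an
    error that shrinks with [k]. *)
Lemma recurrent_dense_sequence (T : Type) (d : T -> T -> R) (t0 : T) :
  pseudometric d -> metric_compact d ->
  exists z : nat -> T, forall w (e : R) K, 0 < e -> exists2 k, (K <= k)%N & d w (z k) < e.
Proof.
move=> dP cT; have [d0 dC dD] := dP.
have netP (m : nat) : exists l : list T, forall x, exists y,
    List.In y l /\ d y x < (m.+1%:R)^-1.
  apply: (cT T (fun y => [set x | d y x < (m.+1%:R)^-1])).
    by move=> y; exact: pseudometric_ball_open.
  by move=> x; exists x => /=; rewrite d0 invr_gt0.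
pose net m := sval (cid (netP m)).
(* Every term of every net occurs: [k.+1 = 2 ^ m * 3 ^ j] codes the [j]-th
   point of the [m]-th net. *)
pose z k := List.nth (logn 3 k.+1) (net (logn 2 k.+1)) t0.
exists z => w e K e0.
pose m := maxn K (Num.truncn e^-1).
have me : (m.+1%:R)^-1 <= e.
  rewrite invf_ple ?posrE//; apply: ltW; apply: lt_le_trans (truncnS_gt _) _.
  by rewrite ler_nat ltnS leq_maxr.
have [y [yl yw]] := svalP (cid (netP m)) w.
have [j [_ jy]] := List.In_nth _ _ t0 yl.
pose k := (2 ^ m * 3 ^ j).-1.
have kS : k.+1 = (2 ^ m * 3 ^ j)%N by rewrite /k prednK// muln_gt0 !expn_gt0.
exists k.
  rewrite -ltnS kS; apply: (@leq_trans (2 ^ m)); last by rewrite leq_pmulr// expn_gt0.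
  by apply: leq_ltn_trans (ltn_expl m (isT : (1 < 2)%N)); exact: leq_maxl.
have -> : z k = y.
  rewrite /z kS !lognM ?expn_gt0// !lognX !logn_prime//= !muln1 !muln0 add0n addn0.
  exact: jy.
by rewrite dC; apply: lt_le_trans yw me.
Qed.

Section finite_point_weights.
Variables (I : finType) (H : Type) (d : H -> H -> R) (v : I -> H).
Hypotheses (dM : is_metric d) (vinj : injective v).

Let dP := is_metric_pseudometric dM.

(** The default value [1] caps the distance, which keeps the legs bounded. *)
Definition min_dist (x : H) : R := \big[Num.min/1]_i d x (v i).

Lemma min_dist_ge0 x : 0 <= min_dist x.
Proof. by apply: le_bigmin => // i _; exact: (pseudometric_ge0 dP). Qed.

Lemma min_dist_le1 x : min_dist x <= 1.
Proof. exact: bigmin_le_id. Qed.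

Lemma min_dist_eq0 x : min_dist x = 0 -> exists i, x = v i.
Proof.
move=> x0; have : min_dist x <= 0 by rewrite x0.
move=> /bigmin_leP[|[i _ xi]]; first by rewrite ler10.
exists i; case: dM => d0 _; apply/d0/eqP.
by rewrite eq_le xi (pseudometric_ge0 dP).
Qed.

Lemma min_dist_v i : min_dist (v i) = 0.
Proof.
apply/eqP; rewrite eq_le min_dist_ge0 andbT.
by apply: le_trans (bigmin_le _ i _) _; case: dP => ->.
Qed.

Lemma min_dist_lip x y : `|min_dist x - min_dist y| <= d x y.
Proof.
have half x' y' : min_dist x' - d x' y' <= min_dist y'.
  apply: le_bigmin => [|i _].
    by have := min_dist_le1 x'; have := pseudometric_ge0 dP x' y'; lra.
  have := bigmin_le 1 i (fun i => d x' (v i)); rewrite -/(min_dist x').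
  by case: dP => _ _ /(_ x' y' (v i)); lra.
rewrite ler_norml; have := half x y; have := half y x.
by case: dP => _ -> _; lra.
Qed.

Definition separation : R := \big[Num.min/1]_(p : I * I | p.1 != p.2) d (v p.1) (v p.2).

Lemma separation_gt0 : 0 < separation.
Proof.
apply: lt_bigmin => // -[i j] /= ij; rewrite lt_neqAle (pseudometric_ge0 dP) andbT.
rewrite eq_sym; apply/eqP; case: dM => d0 _ /d0/vinj ij'.
by rewrite ij' eqxx in ij.
Qed.

(** A tent around [v i] whose radius is small enough to vanish at every other [v j]. *)
Definition bump (x : H) (i : I) : R := Num.max 0 (1 - d x (v i) / separation).

Lemma bump01 x i : in01 (bump x i).
Proof.
split; first by rewrite le_max lexx.
by rewrite ge_max ler01 gerBl divr_ge0 ?(pseudometric_ge0 dP)// ltW// separation_gt0.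
Qed.

Lemma bump_v i j : bump (v i) j = (i == j)%:R.
Proof.
rewrite /bump; have [->|ij] := eqVneq.
  by case: dP => -> _ _; rewrite mul0r subr0 max_r.
rewrite max_l// subr_le0 ler_pdivlMr ?separation_gt0// mul1r.
exact: (@bigmin_le_cond _ _ _ 1 (i, j) _ (fun p => d (v p.1) (v p.2))).
Qed.

Lemma bump_lip x y i : `|bump x i - bump y i| <= d x y / separation.
Proof.
have s0 := separation_gt0; have sV : 0 < separation^-1 by rewrite invr_gt0.
have := pseudometric_distl dP x y (v i); rewrite !ler_norml => /andP[h1 h2].
have {}h1 := ler_wpM2r (ltW sV) h1; have {}h2 := ler_wpM2r (ltW sV) h2.
have dxy := mulr_ge0 (pseudometric_ge0 dP x y) (ltW sV).
rewrite /bump; case: (leP 0 (1 - d x (v i) / separation)) => ?;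
  case: (leP 0 (1 - d y (v i) / separation)) => ?; lra.
Qed.

End finite_point_weights.

Lemma min1_lip (s t : R) : `|Num.min 1 s - Num.min 1 t| <= `|s - t|.
Proof.
have := ler_norm (s - t); have := ler_norm (t - s).
by rewrite (distrC t s) ler_norml; case: (leP 1 s) => ?; case: (leP 1 t) => ?; lra.
Qed.

(** * Recovering a point from its leg lengths *)

Section encoding.
Variables (H : Type) (d : H -> H -> R) (rho : H -> R) (z : nat -> H).
Hypotheses (dP : pseudometric d) (rho0 : forall x, 0 <= rho x).

Definition code (x w : H) : R := rho x * (1 + Num.min 1 (d x w)).

Definition leg (x : H) (k : nat) : R := (2 ^+ k)^-1 * code x (z k).

Let pow_gt0 k : 0 < (2 ^+ k)^-1 :> R.
Proof. by rewrite invr_gt0 exprn_gt0. Qed.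

Let pow_le1 k : (2 ^+ k)^-1 <= 1 :> R.
Proof. by rewrite invf_le1 ?exprn_gt0// exprn_ege1// ler1n. Qed.

Lemma min1_dist x w : 0 <= Num.min 1 (d x w) <= 1.
Proof. by rewrite le_min ler01 (pseudometric_ge0 dP) ge_min lexx. Qed.

Lemma code_bounds x w : rho x <= code x w <= 2 * rho x.
Proof. by rewrite /code; have /andP[? ?] := min1_dist x w; have := rho0 x; nra. Qed.

Lemma leg_ge0 x k : 0 <= leg x k.
Proof.
rewrite mulr_ge0 ?(ltW (pow_gt0 k))//.
by have /andP[/(le_trans (rho0 x))] := code_bounds x (z k).
Qed.

(** Each level halves the scale, while [code x] varies by a factor of at most [2]. *)
Lemma leg_antitone x k l : (k <= l)%N -> leg x l <= leg x k.
Proof.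
have step j : leg x j.+1 <= leg x j.
  rewrite /leg exprS invfM -mulrA mulrCA ler_wpM2l ?(ltW (pow_gt0 j))//.
  have /andP[h1 _] := code_bounds x (z j); have /andP[_ h2] := code_bounds x (z j.+1).
  by rewrite mulrC ler_pdivrMr//; lra.
elim: l => [|l IHl]; first by rewrite leqn0 => /eqP->.
rewrite leq_eqVlt ltnS => /orP[/eqP->//|/IHl]; exact: le_trans.
Qed.

(** At [w := x] and [w := y], with [m] the truncated distance, [rho x = rho y * (1 + m)] and
    [rho y = rho x * (1 + m)]; since [m > 0], both vanish. *)
Lemma code_inj x y : is_metric d -> (forall w, code x w = code y w) ->
  x <> y -> rho x = 0.
Proof.
move=> [d0 _] cxy nxy; have [dx dC _] := dP.
have min10 : Num.min 1 0 = 0 :> R by rewrite min_r.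
have := cxy x; have := cxy y; rewrite /code !dx (dC y x) min10 => h1 h2.
have d_neq0 : d x y != 0 by apply/eqP => /d0.
have m0 : 0 < Num.min 1 (d x y).
  by rewrite lt_min ltr01 lt_neqAle eq_sym d_neq0 (pseudometric_ge0 dP).
move: h1 h2; set m := Num.min _ _ in m0 * => h1 h2.
have h : rho x * (m * (2 + m)) = 0.
  have -> : rho x * (m * (2 + m)) = rho x * (1 + m) * (1 + m) - rho x by ring.
  by rewrite h1; lra.
apply/eqP; move/eqP: h; rewrite mulf_eq0 => /orP[//|].
by rewrite gt_eqF// mulr_gt0//; lra.
Qed.

Hypothesis rho1 : forall x, rho x <= 1.

Lemma code_lipr x w w' : `|code x w - code x w'| <= d w w'.
Proof.
rewrite /code -mulrBr normrM (ger0_norm (rho0 x)).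
have -> : 1 + Num.min 1 (d x w) - (1 + Num.min 1 (d x w')) =
  Num.min 1 (d x w) - Num.min 1 (d x w') by ring.
rewrite -[leRHS]mul1r ler_pM//; apply: le_trans (min1_lip _ _) _.
by case: dP => _ dC _; rewrite !(dC x); exact: pseudometric_distl.
Qed.

(** After division by the scale the error at level [k] is at most [1 / k.+1]; a late [z k] close to
    [w] and the Lipschitz bound in [w] do the rest. *)
Lemma code_le_of_leg x y :
  (forall w (e : R) K, 0 < e -> exists2 k, (K <= k)%N & d w (z k) < e) ->
  (forall k, 2 * leg x k <= (2 ^+ k)^-1 / k.+1%:R + 2 * leg y k) ->
  forall w, code x w <= code y w.
Proof.
move=> z_dense xy w; apply/ler_addgt0Pr => e e0; have e3 : 0 < e / 3 by rewrite divr_gt0.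
have [k Kk wk] := z_dense w _ (Num.truncn (e / 3)^-1) e3.
have ke : (k.+1%:R)^-1 <= e / 3.
  rewrite invf_ple ?posrE//; apply: ltW; apply: lt_le_trans (truncnS_gt _) _.
  by rewrite ler_nat ltnS.
have := xy k; rewrite /leg !(mulrCA 2 _ (code _ _)) -mulrDr ler_pM2l ?pow_gt0// => h.
set u := (k.+1%:R)^-1 in ke h.
have := code_lipr x w (z k); have := code_lipr y w (z k); rewrite !ler_norml.
by lra.
Qed.

Lemma leg_le2 x k : leg x k <= 2 * (2 ^+ k)^-1.
Proof.
rewrite /leg mulrC ler_wpM2r ?(ltW (pow_gt0 k))//.
by have /andP[_] := code_bounds x (z k); have := rho1 x; lra.
Qed.

Lemma leg_lim x e : 0 < e -> exists k, leg x k < e.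
Proof.
move=> e0; pose k := Num.truncn (2 / e); exists k.
apply: le_lt_trans (leg_le2 x k) _.
rewrite ltr_pdivrMr ?exprn_gt0// -ltr_pdivrMl// mulrC.
apply: lt_le_trans (truncnS_gt _) _.
by rewrite -natrX ler_nat ltn_expl.
Qed.

Hypothesis rho_lip : forall x y, `|rho x - rho y| <= d x y.

Lemma code_lipl x y w : `|code x w - code y w| <= 3 * d x y.
Proof.
rewrite /code; set p := Num.min 1 (d x w); set q := Num.min 1 (d y w).
have -> : rho x * (1 + p) - rho y * (1 + q) = (rho x - rho y) * (1 + p) + rho y * (p - q).
  by ring.
have /andP[p0 p1] : 0 <= p <= 1 by exact: min1_dist.
have pq : `|p - q| <= d x y.
  by apply: le_trans (min1_lip _ _) _; exact: pseudometric_distl.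
apply: le_trans (ler_normD _ _) _; rewrite !normrM.
have h1 : `|rho x - rho y| * `|1 + p| <= d x y * 2.
  by rewrite ler_pM// ger0_norm; lra.
have h2 : `|rho y| * `|p - q| <= 1 * d x y by rewrite ler_pM// ger0_norm.
by lra.
Qed.

Lemma leg_lip x y k : `|leg x k - leg y k| <= 3 * d x y.
Proof.
rewrite /leg -mulrBr normrM gtr0_norm ?pow_gt0// -[leRHS]mul1r.
by rewrite ler_pM ?code_lipl ?(ltW (pow_gt0 k)).
Qed.

End encoding.

(** * Construction of the embedding from stars and weighted products *)

Theorem theorem1p1 (n : nat) (hn : (1 <= n)%N)
  (H : topologicalType) (Hcpt : compact [set: H]) (Hmet : metrizable H)
  (v : 'I_n.+1 -> H) (vinj : injective v)
  (S : GHclass) (X : 'I_n.+1 -> CMS)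
  (XS : forall i, in_class S (X i))
  (Xsep : forall i j, i != j -> 0 < dGH (X i) (X j)) :
  exists Phi : H -> CMS,
    GH_embedding S Phi /\ forall i, dGH (Phi (v i)) (X i) = 0.
Proof.
have [d [dM dnbhs]] := Hmet.
have dP := is_metric_pseudometric dM; have dge := pseudometric_ge0 dP.
have cH := compact_metric_compact dM dnbhs Hcpt.
have [zs zs_dense] := recurrent_dense_sequence (v ord0) dP cH.
have Xt i : exists t : X i, True by case: (car_nonempty (X i)) => t; exists t.
pose t i : X i := sval (cid (Xt i)).
pose T := forall o, factor X o.
pose t0 : T := tip t 0.
(* A comparison star independent of [x]: its first [m] legs have length [2], an upper bound for all
   legs. *)
pose b (m q : nat) : R := if (q < m)%N then 2 else 0.
have b0 m q : 0 <= b m q by rewrite /b; case: ifP.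
have b_adm m : admissible (fun _ : 'I_n.+1 => 1) (b m).
  split=> [_|//|e e0]; first exact: in01_1.
  by exists m => q mq; rewrite /b ltnNge mq.
pose delta k : R := (2 ^+ k)^-1 / k.+1%:R.
have delta0 k : 0 < delta k by rewrite divr_gt0// invr_gt0 exprn_gt0.
have clP k m : exists P : nat, exists cl : T -> 'I_P, forall x y, cl x = cl y ->
    product_dist (fun=> 1) (b m) x y <= delta k.
  have bP := product_dist_pseudometric X (b_adm m).
  have bc : metric_compact (product_dist (X := X) (fun=> 1) (b m)).
    by apply/(metric_compact_ultraP bP); exact: product_dist_ultra_compact.
  exact (metric_compact_classes bP bc (delta0 k)).
(* The legs of levels up to [k] outnumber the classes at scale [delta k] of the product with the
   star cut before level [k]. *)
have [N [lev [NP levP]]] := levels (fun k m => sval (cid (clP k m))).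
pose rho := min_dist d v.
have rho0 : forall x, 0 <= rho x := min_dist_ge0 v dM.
have rho1 : forall x, rho x <= 1 := min_dist_le1 d v.
have rho_lip : forall x y, `|rho x - rho y| <= d x y := min_dist_lip v dM.
pose L x k := leg d rho zs x k.
have L0 x k : 0 <= L x k := leg_ge0 zs dP rho0 x k.
have L_anti x k l : (k <= l)%N -> L x l <= L x k := @leg_antitone _ _ _ zs dP rho0 x k l.
pose a x q := L x (lev q).
have adm x : admissible (bump d v x) (a x).
  split=> [i|q|e e0]; [exact: bump01|exact: L0|].
  have [k ke] := leg_lim zs dP rho0 rho1 x e0; exists (N k) => q.
  by rewrite levP => kq; apply: le_lt_trans ke; exact: L_anti.
pose D x := product_dist (X := X) (bump d v x) (a x).
have DP x : pseudometric (D x) := product_dist_pseudometric X (adm x).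
have PhiP x : exists (Q : CMS) (pi : T -> Q), (forall q, exists t, pi t = q) /\
    forall u w, dist (pi u) (pi w) = D x u w.
  exact: (metric_quotient t0 (DP x) (product_dist_ultra_compact (adm x))).
pose Phi x : CMS := sval (cid (PhiP x)).
pose pi x : T -> Phi x := sval (cid (svalP (cid (PhiP x)))).
have pis x : forall q, exists t, pi x t = q.
  by case: (svalP (cid (svalP (cid (PhiP x))))).
have pid x u w : dist (pi x u) (pi x w) = D x u w.
  by case: (svalP (cid (svalP (cid (PhiP x))))) => _; exact.
have PhiS x : in_class S (Phi x).
  exact: quotient_in_class (pis x) (pid x) (product_dist_class XS (adm x)).
have Phi_v i : dGH (Phi (v i)) (X i) <= 0.
  have rv : rho (v i) = 0 := min_dist_v v dM i.
  have av q : a (v i) q = 0 by rewrite /a /L /leg /code rv mul0r mulr0.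
  (* At [v i] all legs and all other weights vanish, so only the coordinate [Some i] is seen. *)
  have Dv u w : D (v i) u w = dist (u (Some i)) (w (Some i)).
    rewrite /D /product_dist /l2_dist /l2norm (bigD1 (Some i))//= big1.
      rewrite addr0 bump_v// eqxx mul1r sqrtr_sqr ger0_norm//.
      exact: (pseudometric_ge0 (dist_pseudometric _)).
    case=> [j|] /= ji.
      by rewrite bump_v// (_ : (i == j) = false) ?mul0r ?expr0n//; apply/eqP => ij;
        rewrite ij eqxx in ji.
    by rewrite /star_dist /star_pos !av !mul0r subrr normr0 addr0 if_same expr0n.
  apply: (@dGH_le_distortion _ _ 0
    (fun p q => exists2 u, pi (v i) u = p & u (Some i) = q)) => //; split.
  - by move=> p; have [u up] := pis _ p; exists (u (Some i)), u.
  - move=> q; exists (pi (v i) (dfwith t0 (Some i) q)).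
    by exists (dfwith t0 (Some i) q) => //; rewrite dfwithin.
  - by move=> _ _ _ _ [u <- <-] [w <- <-]; rewrite pid Dv subrr normr0.
pose s := separation d v; have s0 : 0 < s := separation_gt0 dM vinj.
have XB i : exists B : R, forall u w : X i, dist u w <= B.
  exact: metric_compact_bounded (dist_pseudometric _) (@car_compact (X i)).
pose B : R := \sum_i sval (cid (XB i)).
have XBB i (u w : X i) : dist u w <= B.
  have B0 j : 0 <= sval (cid (XB j)).
    apply: le_trans (svalP (cid (XB j)) (t j) (t j)).
    exact: (pseudometric_ge0 (dist_pseudometric _)).
  apply: le_trans (svalP (cid (XB i)) u w) _.
  by rewrite /B (bigD1 i)//= lerDl sumr_ge0.
have B0 : 0 <= B.
  apply: le_trans (XBB ord0 (t ord0) (t ord0)).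
  exact: (pseudometric_ge0 (dist_pseudometric _)).
(* Per factor, [B / s] bounds the change of the weighted metrics and [6 = 2 * 3] that of the
   star. *)
pose K : R := #|{: option 'I_n.+1}|%:R * (B / s + 6).
have Bs0 : 0 <= B / s by rewrite divr_ge0// ltW.
have K0 : 0 <= K by rewrite mulr_ge0// addr_ge0.
have Phi_lip x y : dGH (Phi x) (Phi y) <= K * d x y.
  (* Images of the same point of [T] are related. *)
  apply: (@dGH_le_distortion _ _ _
    (fun p q => exists2 u, pi x u = p & pi y u = q)); first exact: mulr_ge0.
  split=> [p|q|_ _ _ _ [u <- <-] [w <- <-]].
  - by have [u up] := pis x p; exists (pi y u), u.
  - by have [u uq] := pis y q; exists (pi x u), u.
  have dxy := dge x y.
  rewrite !pid /K -mulrA; apply: (product_dist_lip (B := B)) => //.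
  - by rewrite mulr_ge0// addr_ge0.
  - move=> i; have := ler_wpM2r B0 (bump_lip dM vinj x y i).
    have -> : d x y / separation d v * B = B / s * d x y by rewrite /s; ring.
    by lra.
  - move=> q; have := leg_lip zs dP rho0 rho1 rho_lip x y (lev q).
    have := mulr_ge0 Bs0 dxy; rewrite -/(L x (lev q)) -/(L y (lev q)) /a.
    by lra.
(* In [Phi x] the tips of the first [N k.+1] legs are pairwise at least [2 * L x k] apart, while
   fewer classes of diameter at most [delta k + 2 * L y k] cover [Phi y]. *)
have leg_le x y k : dGH (Phi x) (Phi y) <= 0 -> 2 * L x k <= delta k + 2 * L y k.
  move=> xy; have := svalP (cid (clP k (N k))); have := NP k.
  set P := sval _ => PN [cl clD].
  apply: (@pointwise_le_of_dGH0 T _ _ _ _ _ _ _ _ (tip t) cl _ _ (pis y)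
    (pid x) (pid y) PN _ _ xy).
  - have levk q : (q < N k.+1)%N -> L x k <= a x q.
      by rewrite ltnNge levP -ltnNge ltnS => qk; exact: L_anti.
    move=> q q' /levk h /levk h' qq'.
    have ax0 q1 : 0 <= a x q1 by exact: L0.
    have := product_dist_tip (bump d v x) t ax0 qq'; rewrite -/(D x _ _); lra.
  - move=> u w /clD uw.
    have ay0 q : 0 <= a y q by exact: L0.
    apply: le_trans (product_dist_le (b := b (N k)) (eta := L y k) u w _ _ _ _ _) _.
    + exact: L0.
    + by move=> i; exact: bump01.
    + exact: ay0.
    + exact: b0.
    (* Legs before level [k] are at most [2], the later ones at most [L y k]. *)
    + move=> q; rewrite /b; case: ltnP => [_|].
        left; have := leg_le2 zs dP rho0 rho1 y (lev q).
        have : (2 ^+ lev q)^-1 <= 1 :> R.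
          by rewrite invf_le1 ?exprn_gt0// exprn_ege1// ler1n.
        by rewrite /a /L; lra.
      by rewrite levP => kq; right; exact: L_anti.
    by lra.
have dGH0_sym Y Z : dGH Y Z <= 0 -> dGH Z Y <= 0.
  move=> YZ; apply/ler_addgt0Pr => e e0; rewrite add0r.
  have e2 : 0 < e / 2 by rewrite divr_gt0.
  by have := dGH_sym_le (le_lt_trans YZ e2); lra.
have dGH0_trans Y Z W : dGH Y Z <= 0 -> dGH Z W <= 0 -> dGH Y W <= 0.
  move=> YZ ZW; apply/ler_addgt0Pr => e e0; rewrite add0r.
  have e4 : 0 < e / 4 by rewrite divr_gt0.
  by have := dGH_quasi_triangle (le_lt_trans YZ e4) (le_lt_trans ZW e4); lra.
have Phi_inj x y : x <> y -> 0 < dGH (Phi x) (Phi y).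
  move=> nxy; rewrite ltNge; apply/negP => xy.
  have yx := dGH0_sym _ _ xy.
  have code_le x' y' (xy' : dGH (Phi x') (Phi y') <= 0) w :
      code d rho x' w <= code d rho y' w.
    exact (code_le_of_leg dP rho0 rho1 zs_dense (fun k => leg_le x' y' k xy') w).
  have code_eq w : code d rho x w = code d rho y w.
    by apply/eqP; rewrite eq_le (code_le _ _ xy) (code_le _ _ yx).
  (* Equal codes at distinct points force [rho] to vanish at both, so they are two of the [v i],
     whose images [Xsep] keeps apart. *)
  have [i xi] := min_dist_eq0 dM (code_inj dP dM code_eq nxy).
  have [j yj] := min_dist_eq0 dM (code_inj dP dM (fun w => esym (code_eq w)) (nesym nxy)).
  have ij : i != j by apply/eqP => ij; apply: nxy; rewrite xi yj ij.
  have := Xsep i j ij; rewrite ltNge => /negP; apply.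
  apply: (dGH0_trans _ _ _ (dGH0_sym _ _ (Phi_v i))); rewrite xi yj in xy.
  exact: (dGH0_trans _ _ _ xy (Phi_v j)).
exists Phi; split; last first.
  by move=> i; apply/eqP; rewrite eq_le Phi_v dGH_ge0.
split=> // [x e e0|x U Ux].
  apply/dnbhs; exists (e / (K + 1)); split; first by rewrite divr_gt0//; lra.
  move=> y; rewrite ltr_pdivlMr => [xy|]; last by lra.
  by apply: le_lt_trans (Phi_lip x y) _; have := dge x y; lra.
apply: contrapT => /forall2NP nU.
(* If no radius works, the points outside [U] with image close to [Phi x] form a proper filter,
   which clusters at some [y]. *)
pose F := filter_from [set e : R | 0 < e]
  (fun e => [set y | dGH (Phi x) (Phi y) < e /\ ~ U y]).
have FF : ProperFilter F.
  apply: filter_from_proper.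
    apply: filter_from_filter; first by exists 1 => /=.
    move=> e1 e2 /= e10 e20; exists (Num.min e1 e2); first by rewrite /= lt_min e10.
    by move=> y [/=]; rewrite lt_min => /andP[].
  move=> e /= e0; have [//|/existsNP[y /not_implyP[xy nUy]]] := nU e.
  by exists y.
have [y [_ yF]] := Hcpt F FF filterT.
have ball e : 0 < e -> nbhs y [set w | d w y < e].
  move=> e0; apply/dnbhs; exists e; split=> // w; by case: dP => _ ->.
have [xy|xy] := pselect (x = y).
  have FnU : F (~` U) by exists 1 => //= w [].
  rewrite -xy in yF; by have [w []] := yF _ _ FnU Ux.
(* For [y] other than [x], a point [w] near [y] with image near [Phi x] makes [dGH (Phi x) (Phi y)]
   arbitrarily small. *)
have := Phi_inj x y xy; apply/negP; rewrite -leNgt; apply/ler_addgt0Pr => e e0.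
rewrite add0r.
have e4 : 0 < e / 4 by rewrite divr_gt0.
have Fe : F [set w | dGH (Phi x) (Phi w) < e / 4] by exists (e / 4) => // w [].
have r0 : 0 < e / 4 / (K + 1) by rewrite divr_gt0//; lra.
have [w [xw wy]] := yF _ _ Fe (ball _ r0).
move: xw wy => /= xw; rewrite ltr_pdivlMr => [wy|]; last by lra.
have wy' : dGH (Phi w) (Phi y) < e / 4.
  by apply: le_lt_trans (Phi_lip w y) _; have := dge w y; lra.
have -> : e = 2 * (e / 4 + e / 4) by field.
exact: dGH_quasi_triangle xw wy'.
Qed.
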